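(* Assume that the diffusion coefficient does not depend on the control, $\sigma(t,x,u)=\sigma(t,x)$, and that $b,\sigma,g,h,\psi$ satisfy the standing assumptions listed in the context. Let $\Theta:D[0,T]\times\mathbb{R}^n\to\mathbb{R}$ be the solution of the equilibrium HJB equation $$\begin{cases} \Theta_t(\tau,t,x)+\mathrm{tr}\big[a(t,x)\Theta_{xx}(\tau,t,x)\big]+\big\langle b(t,x,\mathbf{u}(t,x)),\Theta_x(\tau,t,x)\big\rangle\\ \qquad+\,g\big(\tau,t,x,\mathbf{u}(t,x),\Theta(\tau,t,x),\Theta_x(\tau,t,x)^\top\sigma(t,x)\big)=0, & (\tau,t,x)\in D[0,T]\times\mathbb{R}^n,\\ \Theta(\tau,T,x)=h(\tau,x), & (\tau,x)\in[0,T]\times\mathbb{R}^n,\end{cases}$$ where $\mathbf{u}(t,x)=\psi\big(t,t,x,\Theta(t,t,x),\Theta_x(t,t,x)\big)$, and for each partition $\Pi$ of $[0,T]$ let $\Theta^\Pi$ be the function constructed from the $N$-person game recursion described in the context. Then $$\lim_{\|\Pi\|\to0}\Big(|\Theta^\Pi(\tau,t,x)-\Theta(\tau,t,x)|+|\Theta^\Pi_x(\tau,t,x)-\Theta_x(\tau,t,x)|\Big)=0,\qquad(\tau,t,x)\in D[0,T]\times\mathbb{R}^n,$$ uniformly for $(\tau,t,x)$ in any compact set.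
   Context: Notation. $T>0$; $U\subseteq\mathbb{R}^m$ nonempty; $D[0,T]=\{(\tau,t)\in[0,T]^2:0\le\tau\le t\le T\}$; $\mathbb{S}^n$ is the set of symmetric $n\times n$ matrices; $a(t,x)=\frac12\sigma(t,x)\sigma(t,x)^\top$. The maps are $b:[0,T]\times\mathbb{R}^n\times U\to\mathbb{R}^n$, $\sigma:[0,T]\times\mathbb{R}^n\to\mathbb{R}^{n\times d}$, $g:D[0,T]\times\mathbb{R}^n\times U\times\mathbb{R}\times\mathbb{R}^{1\times d}\to\mathbb{R}$ (written $g(\tau,t,x,u,y,z)$), $h:[0,T]\times\mathbb{R}^n\to\mathbb{R}$ (written $h(\tau,x)$). The Hamiltonian is $$\mathbb{H}(\tau,t,x,u,\theta,p,P)=\mathrm{tr}[a(t,x)P]+\langle b(t,x,u),p\rangle+g\big(\tau,t,x,u,\theta,p^\top\sigma(t,x)\big).$$ Standing assumptions. (1) $b,\sigma,g,h$ are continuous, Lipschitz in $(x,y,z)$ uniformly in the remaining variables, and $|b(s,0,u)|+|\sigma(s,0)|+|g(\tau,s,0,u,0,0)|\le L(1+|u|)$ for a constant $L>0$. (2) There is a map $\psi:D[0,T]\times\mathbb{R}^n\times\mathbb{R}\times\mathbb{R}^n\to U$ such that for all $(\tau,t,x,\theta,p)$ and all $P\in\mathbb{S}^n$, $\psi(\tau,t,x,\theta,p)$ minimizes $u\mapsto\mathbb{H}(\tau,t,x,u,\theta,p,P)$ over $U$. (3) All the functions $b,\sigma,g,h,\psi$ are bounded and continuously differentiable with bounded derivatives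 (differentiability in $u\in U$ meaning that the map is the restriction of such a map defined for $u\in\mathbb{R}^m$). In particular, for a constant $K>0$, $|h_\tau(\tau,x)|+|g_\tau(\tau,t,x,u,y,z)|\le K$ everywhere. (4) Assumption (A): the maps $a$, $\tilde b(t,x,\bar\theta,\bar p)=b(t,x,\psi(t,t,x,\bar\theta,\bar p))$, $\tilde g(\tau,t,x,\bar\theta,\bar p,\theta,p)=g(\tau,t,x,\psi(t,t,x,\bar\theta,\bar p),\theta,p^\top\sigma(t,x))$ and $h$ are continuous and bounded; there is $L>0$ with $$|a_x|+|\tilde b_x|+|\tilde g_x|+|\tilde b_{\bar\theta}|+|\tilde g_{\bar\theta}|+|\tilde b_{\bar p}|+|\tilde g_{\bar p}|+|\tilde g_\theta|+|\tilde g_p|+|h_x|+|h_{\tau x}|\le L$$ everywhere; and $a(t,x)^{-1}$ exists with $\lambda_0I\le a(t,x)^{-1}\le\lambda_1I$ for all $(t,x)\in[0,T]\times\mathbb{R}^n$, for some constants $\lambda_0,\lambda_1>0$. Solutions of the PDEs below and of the equilibrium HJB equation are classical solutions, bounded together with their $x$-gradients; they are taken to exist. Construction of $\Theta^\Pi$. Let $\Pi:0=t_0<t_1<\dots<t_N=T$, with mesh $\|\Pi\|=\max_{1\le k\le N}(t_k-t_{k-1})$. Functions $\mathbf{u}^\Pi:[0,T]\times\mathbb{R}^n\to U$ and $\Theta^k:[t_{k-1},T]\times\mathbb{R}^n\to\mathbb{R}$ are defined by backward recursion over $k=N,N-1,\dots,1$. Given $\mathbf{u}^\Pi$ on $[t_k,T]\times\mathbb{R}^n$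 (nothing is needed for $k=N$): (i) On $[t_k,T]\times\mathbb{R}^n$, $\Theta^k$ is the solution of $$\Theta^k_t(t,x)+\mathbb{H}\big(t_{k-1},t,x,\mathbf{u}^\Pi(t,x),\Theta^k(t,x),\Theta^k_x(t,x),\Theta^k_{xx}(t,x)\big)=0,\qquad\Theta^k(T,x)=h(t_{k-1},x)$$ (for $k=N$ this is just the terminal condition $\Theta^N(T,x)=h(t_{N-1},x)$). Here $\Theta^k$ is continuous and the equation is understood classically on each subinterval $[t_{j-1},t_j)$; $\Theta^k_x,\Theta^k_{xx}$ may jump at the partition points. (ii) On $[t_{k-1},t_k)\times\mathbb{R}^n$, $\Theta^k$ is the solution of the HJB equation $$\Theta^k_t(t,x)+\inf_{u\in U}\mathbb{H}\big(t_{k-1},t,x,u,\Theta^k(t,x),\Theta^k_x(t,x),\Theta^k_{xx}(t,x)\big)=0,$$ with terminal value $\Theta^k(t_k,\cdot)$ at $t=t_k$ obtained in (i). (iii) $\mathbf{u}^\Pi(t,x)=\psi\big(t_{k-1},t,x,\Theta^k(t,x),\Theta^k_x(t,x)\big)$ for $(t,x)\in[t_{k-1},t_k)\times\mathbb{R}^n$. Finally $\Theta^\Pi(\tau,t,x)=\Theta^k(t,x)$ for $\tau\in[t_{k-1},t_k)$, $t\in[\tau,T]$, $x\in\mathbb{R}^n$, $k=1,\dots,N$, where for $k=N$ the interval $[t_{N-1},t_N)$ is replaced by $[t_{N-1},t_N]$. Equivalently, with $\ell^\Pi(t)=t_{k-1}$ for $t\in[t_{k-1},t_k)$, and with $g^\Pi(\tau,\cdot)=g(t_{k-1},\cdot)$,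 $h^\Pi(\tau,\cdot)=h(t_{k-1},\cdot)$ for $\tau\in[t_{k-1},t_k)$, $\Theta^\Pi$ satisfies $$\Theta^\Pi_t(\tau,t,x)+\mathrm{tr}[a(t,x)\Theta^\Pi_{xx}(\tau,t,x)]+\langle b(t,x,\mathbf{u}^\Pi(t,x)),\Theta^\Pi_x(\tau,t,x)\rangle+g^\Pi\big(\tau,t,x,\mathbf{u}^\Pi(t,x),\Theta^\Pi(\tau,t,x),\Theta^\Pi_x(\tau,t,x)^\top\sigma(t,x)\big)=0,$$ $\Theta^\Pi(\tau,T,x)=h^\Pi(\tau,x)$, with $\mathbf{u}^\Pi(t,x)=\psi(\ell^\Pi(t),t,x,\Theta^\Pi(t,t,x),\Theta^\Pi_x(t,t,x))$. *)

(* Defs.v *)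
(* Vectors of R^n are column vectors; `|_| on vectors,
   matrices and tuples is the library's sup norm, which is equivalent to the
   Euclidean one. *)
From HB Require Import structures.
From mathcomp Require Import all_boot all_order all_algebra.
From mathcomp Require Import all_classical all_reals all_analysis.

Set Implicit Arguments.
Unset Strict Implicit.
Unset Printing Implicit Defensive.

Import Order.TTheory GRing.Theory Num.Theory.
Import numFieldNormedType.Exports.

Local Open Scope classical_set_scope.
Local Open Scope ring_scope.

Section Uncurry.
Context {A1 A2 A3 A4 A5 A6 A7 B : Type}.

Definition unc2 (f : A1 -> A2 -> B) (q : A1 * A2) : B := f q.1 q.2.

Definition unc3 (f : A1 -> A2 -> A3 -> B) (q : A1 * A2 * A3) : B :=
  f q.1.1 q.1.2 q.2.

Definition unc4 (f : A1 -> A2 -> A3 -> A4 -> B) (q : A1 * A2 * A3 * A4) : B :=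
  f q.1.1.1 q.1.1.2 q.1.2 q.2.

Definition unc5 (f : A1 -> A2 -> A3 -> A4 -> A5 -> B)
    (q : A1 * A2 * A3 * A4 * A5) : B :=
  f q.1.1.1.1 q.1.1.1.2 q.1.1.2 q.1.2 q.2.

Definition unc6 (f : A1 -> A2 -> A3 -> A4 -> A5 -> A6 -> B)
    (q : A1 * A2 * A3 * A4 * A5 * A6) : B :=
  f q.1.1.1.1.1 q.1.1.1.1.2 q.1.1.1.2 q.1.1.2 q.1.2 q.2.

Definition unc7 (f : A1 -> A2 -> A3 -> A4 -> A5 -> A6 -> A7 -> B)
    (q : A1 * A2 * A3 * A4 * A5 * A6 * A7) : B :=
  f q.1.1.1.1.1.1 q.1.1.1.1.1.2 q.1.1.1.1.2 q.1.1.1.2 q.1.1.2 q.1.2 q.2.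

End Uncurry.

Section Calculus.
Context {R : realType}.

(* Operator norm of the differential of f at x; meaningful where f is
   differentiable (the library has no operator norm). *)
Definition dnorm (V W : normedModType R) (f : V -> W) (x : V) : R :=
  sup [set `|'d f x v| | v in [set v : V | `|v| <= 1]].

Definition bounded_over (V W : normedModType R) (A : set V) (f : V -> W) :=
  exists M : R, forall x, A x -> `|f x| <= M.

(* Bounded and continuously differentiable with bounded derivatives on A: f is
   the restriction to A of such a map on the whole space.  For the time
   variables (closed interval, closed triangle) this is the same as C^1 up to
   the boundary with bounded one-sided derivatives, by extension through
   successive reflections. *)
Definition C1b_on (V W : normedModType R) (A : set V) (f : V -> W) :=
  exists F : V -> W,
    [/\ forall x, A x -> F x = f x,
        forall x, differentiable F x,
        forall v, continuous (fun x => 'd F x v),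
        bounded_over setT F &
        exists K : R, forall x, dnorm F x <= K].

(* Derivative at t of f : I -> R relative to the time set I; it is one-sided at
   an end point of an interval I. *)
Definition tquot (I : set R) (f : R -> R) (t : R) :=
  (fun s => (f s - f t) / (s - t)) @ within I t^'.

Definition tderivable (I : set R) (f : R -> R) (t : R) : Prop :=
  cvg (tquot I f t).

Definition tderiv (I : set R) (f : R -> R) (t : R) : R := lim (tquot I f t).

Definition inner (n : nat) (u v : 'cV[R]_n) : R := \sum_(i < n) u i 0 * v i 0.

Definition grad (n : nat) (f : 'cV[R]_n -> R) (x : 'cV[R]_n) : 'cV[R]_n :=
  \col_(i < n) 'd f x (delta_mx i 0).

Definition hess (n : nat) (f : 'cV[R]_n -> R) (x : 'cV[R]_n) : 'M[R]_n :=
  \matrix_(i < n, j < n) ('d (grad f) x (delta_mx j 0) : 'cV[R]_n) i 0.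

(* A <= B for the Loewner order. *)
Definition loewner_le (n : nat) (A B : 'M[R]_n) : Prop :=
  forall xi : 'cV[R]_n, inner xi (A *m xi) <= inner xi (B *m xi).

(* v(t, x) is C^{1,2} on I x R^n. *)
Definition C12_on (n : nat) (I : set R) (v : R -> 'cV[R]_n -> R) : Prop :=
  [/\ forall t x, I t -> [/\ tderivable I (v^~ x) t,
                             differentiable (v t) x &
                             differentiable (grad (v t)) x],
      {within I `*` setT,
         continuous (unc2 (fun t x => tderiv I (v^~ x) t))},
      {within I `*` setT, continuous (unc2 (fun t x => grad (v t) x))} &
      {within I `*` setT, continuous (unc2 (fun t x => hess (v t) x))}].

End Calculus.

Section Coefficients.
Context {R : realType} {n d m : nat}.
Variables (T : R) (U : set 'cV[R]_m).
Variables (b : R -> 'cV[R]_n -> 'cV[R]_m -> 'cV[R]_n).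
Variables (sigma : R -> 'cV[R]_n -> 'M[R]_(n, d)).
Variables (g : R -> R -> 'cV[R]_n -> 'cV[R]_m -> R -> 'rV[R]_d -> R).
Variables (h : R -> 'cV[R]_n -> R).
Variables (psi : R -> R -> 'cV[R]_n -> R -> 'cV[R]_n -> 'cV[R]_m).

Definition timeI : set R := `[0, T].

Definition timeD : set (R * R) := [set q | 0 <= q.1 /\ q.1 <= q.2 <= T].

Definition acoef (t : R) (x : 'cV[R]_n) : 'M[R]_n :=
  2^-1 *: (sigma t x *m (sigma t x)^T).

Definition Hamiltonian (tau t : R) (x : 'cV[R]_n) (u : 'cV[R]_m)
    (theta : R) (p : 'cV[R]_n) (P : 'M[R]_n) : R :=
  \tr (acoef t x *m P) + inner (b t x u) p
  + g tau t x u theta (p^T *m sigma t x).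

Definition coef_continuous : Prop :=
  [/\ {within timeI `*` setT `*` U, continuous (unc3 b)},
      {within timeI `*` setT, continuous (unc2 sigma)},
      {within [set q | timeD q.1.1.1.1 /\ U q.1.1.2],
         continuous (unc6 g)} &
      {within timeI `*` setT, continuous (unc2 h)}].

Definition coef_lipschitz : Prop :=
  exists L : R,
    [/\ forall t x x' u, timeI t -> U u ->
          `|b t x u - b t x' u| <= L * `|x - x'|,
        forall t x x', timeI t ->
          `|sigma t x - sigma t x'| <= L * `|x - x'|,
        forall tau t x x' u y y' z z', timeD (tau, t) -> U u ->
          `|g tau t x u y z - g tau t x' u y' z'|
            <= L * (`|x - x'| + `|y - y'| + `|z - z'|) &
        forall tau x x', timeI tau ->
          `|h tau x - h tau x'| <= L * `|x - x'|].

Definition coef_growth : Prop :=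
  exists2 L : R, 0 < L &
    forall tau s u, timeD (tau, s) -> U u ->
      `|b s 0 u| + `|sigma s 0| + `|g tau s 0 u 0 0| <= L * (1 + `|u|).

Definition psi_minimizes : Prop :=
  forall tau t x theta p, timeD (tau, t) ->
    U (psi tau t x theta p) /\
    forall P : 'M[R]_n, P^T = P -> forall u, U u ->
      Hamiltonian tau t x (psi tau t x theta p) theta p P
        <= Hamiltonian tau t x u theta p P.

Definition coef_smooth : Prop :=
  [/\ C1b_on (timeI `*` setT `*` U) (unc3 b),
      C1b_on (timeI `*` setT) (unc2 sigma),
      C1b_on [set q | timeD q.1.1.1.1 /\ U q.1.1.2] (unc6 g),
      C1b_on (timeI `*` setT) (unc2 h) &
      C1b_on [set q | timeD q.1.1.1] (unc5 psi)].

Definition btilde (t : R) (x : 'cV[R]_n) (thetab : R) (pb : 'cV[R]_n) :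
    'cV[R]_n :=
  b t x (psi t t x thetab pb).

Definition gtilde (tau t : R) (x : 'cV[R]_n) (thetab : R) (pb : 'cV[R]_n)
    (theta : R) (p : 'cV[R]_n) : R :=
  g tau t x (psi t t x thetab pb) theta (p^T *m sigma t x).

Definition htau (tau : R) (x : 'cV[R]_n) : R := tderiv timeI (h^~ x) tau.

Definition assumptionA_cont_bounded : Prop :=
  [/\ {within timeI `*` setT, continuous (unc2 acoef)} /\
        bounded_over (timeI `*` setT) (unc2 acoef),
      {within [set q | timeI q.1.1.1], continuous (unc4 btilde)} /\
        bounded_over [set q | timeI q.1.1.1] (unc4 btilde),
      {within [set q | timeD q.1.1.1.1.1], continuous (unc7 gtilde)} /\
        bounded_over [set q | timeD q.1.1.1.1.1] (unc7 gtilde) &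
      {within timeI `*` setT, continuous (unc2 h)} /\
        bounded_over (timeI `*` setT) (unc2 h)].

Definition assumptionA_differentiable : Prop :=
  forall tau t x thetab pb theta p, timeD (tau, t) ->
    [/\ differentiable (acoef t) x,
        [/\ differentiable (fun y => btilde t y thetab pb) x,
            differentiable (fun y => btilde t x y pb) thetab &
            differentiable (fun y => btilde t x thetab y) pb],
        [/\ differentiable (fun y => gtilde tau t y thetab pb theta p) x,
            differentiable (fun y => gtilde tau t x y pb theta p) thetab,
            differentiable (fun y => gtilde tau t x thetab y theta p) pb,
            differentiable (fun y => gtilde tau t x thetab pb y p) theta &
            differentiable (fun y => gtilde tau t x thetab pb theta y) p] &
        [/\ differentiable (h tau) x,
            forall y, tderivable timeI (h^~ y) tau &
            differentiable (htau tau) x]].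

Definition assumptionA_bound : Prop :=
  exists2 L : R, 0 < L &
    forall tau t x thetab pb theta p, timeD (tau, t) ->
      dnorm (acoef t) x
      + dnorm (fun y => btilde t y thetab pb) x
      + dnorm (fun y => gtilde tau t y thetab pb theta p) x
      + dnorm (fun y => btilde t x y pb) thetab
      + dnorm (fun y => gtilde tau t x y pb theta p) thetab
      + dnorm (fun y => btilde t x thetab y) pb
      + dnorm (fun y => gtilde tau t x thetab y theta p) pb
      + dnorm (fun y => gtilde tau t x thetab pb y p) theta
      + dnorm (fun y => gtilde tau t x thetab pb theta y) p
      + dnorm (h tau) x
      + dnorm (htau tau) x <= L.

Definition uniformly_elliptic : Prop :=
  exists lambda0 lambda1 : R,
    [/\ 0 < lambda0, 0 < lambda1 &
        forall t x, timeI t ->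
          [/\ acoef t x \in unitmx,
              loewner_le lambda0%:M (invmx (acoef t x)) &
              loewner_le (invmx (acoef t x)) lambda1%:M]].

Definition assumptionA : Prop :=
  [/\ assumptionA_cont_bounded, assumptionA_differentiable,
      assumptionA_bound & uniformly_elliptic].

Definition standing_assumptions : Prop :=
  [/\ [/\ coef_continuous, coef_lipschitz & coef_growth],
      psi_minimizes, coef_smooth & assumptionA].

(* The equilibrium control attached to Theta, read on the diagonal tau = t. *)
Definition equilibrium_control (Theta : R -> R -> 'cV[R]_n -> R)
    (t : R) (x : 'cV[R]_n) : 'cV[R]_m :=
  psi t t x (Theta t t x) (grad (Theta t t) x).

(* As usual for terminal value problems, a classical solution is continuous up
   to t = T, while the equation and the regularity it needs are imposed for
   t < T only (h is merely C^1, so Theta_xx need not exist at t = T).  The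
   joint continuity in tau makes the diagonal values depend continuously
   on (t, x). *)
Definition equilibrium_HJB_solution (Theta : R -> R -> 'cV[R]_n -> R) : Prop :=
  [/\ {within timeD `*` setT, continuous (fun q => Theta q.1.1 q.1.2 q.2)} /\
        {within [set q : R * R * 'cV[R]_n | timeD q.1 /\ q.1.2 < T],
           continuous (fun q => grad (Theta q.1.1 q.1.2) q.2)},
      exists M : R, forall tau t x, timeD (tau, t) ->
        `|Theta tau t x| <= M /\ `|grad (Theta tau t) x| <= M,
      forall tau, timeI tau -> C12_on `[tau, T[ (Theta tau),
      forall tau t x, timeD (tau, t) -> t < T ->
        tderiv `[tau, T[ (fun s => Theta tau s x) t
        + \tr (acoef t x *m hess (Theta tau t) x)
        + inner (b t x (equilibrium_control Theta t x)) (grad (Theta tau t) x)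
        + g tau t x (equilibrium_control Theta t x) (Theta tau t x)
            ((grad (Theta tau t) x)^T *m sigma t x) = 0 &
      forall tau x, timeI tau -> Theta tau T x = h tau x].

(* A partition 0 = t_0 < t_1 < ... < t_N = T is given by the sequence
   s = [:: t_1; ...; t_N], with itv_partition 0 T s; so N = size s. *)
Definition pt (s : seq R) (k : nat) : R := nth T (0 :: s) k.

Definition mesh (s : seq R) : R :=
  \big[Num.max/0]_(1 <= k < (size s).+1) (pt s k - pt s k.-1).

(* The k-th subinterval [t_{k-1}, t_k), for k = 1, ..., N. *)
Definition piece (s : seq R) (k : nat) : set R := `[pt s k.-1, pt s k[.

(* Th k is Theta^k, on [t_{k-1}, T] x R^n, for k = 1, ..., N.  The three last
   conditions are the steps (i), (ii), (iii) of the recursion. *)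
Definition game_recursion (s : seq R) (uPi : R -> 'cV[R]_n -> 'cV[R]_m)
    (Th : nat -> R -> 'cV[R]_n -> R) : Prop :=
  (forall t x, timeI t -> U (uPi t x)) /\
  forall k, (0 < k <= size s)%N ->
    [/\ [/\ {within `[pt s k.-1, T] `*` setT, continuous (unc2 (Th k))},
            exists M : R, forall t x, pt s k.-1 <= t <= T ->
              `|Th k t x| <= M /\ `|grad (Th k t) x| <= M &
            forall x, Th k T x = h (pt s k.-1) x],
        forall j, (k < j <= size s)%N ->
          C12_on (piece s j) (Th k) /\
          forall t x, piece s j t ->
            tderiv (piece s j) ((Th k)^~ x) t
            + Hamiltonian (pt s k.-1) t x (uPi t x)
                (Th k t x) (grad (Th k t) x) (hess (Th k t) x) = 0,
        C12_on (piece s k) (Th k) /\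
        (forall t x, piece s k t ->
           tderiv (piece s k) ((Th k)^~ x) t
           + inf [set Hamiltonian (pt s k.-1) t x u
                    (Th k t x) (grad (Th k t) x) (hess (Th k t) x) | u in U]
           = 0) &
        forall t x, piece s k t ->
          uPi t x = psi (pt s k.-1) t x (Th k t x) (grad (Th k t) x)].

(* ThetaPi is the function Theta^Pi assembled from the Theta^k. *)
Definition game_value (s : seq R) (ThetaPi : R -> R -> 'cV[R]_n -> R) : Prop :=
  exists uPi : R -> 'cV[R]_n -> 'cV[R]_m,
  exists2 Th : nat -> R -> 'cV[R]_n -> R, game_recursion s uPi Th &
    forall k tau t x, (0 < k <= size s)%N ->
      (pt s k.-1 <= tau < pt s k) || ((k == size s) && (tau == T)) ->
      tau <= t <= T ->
      ThetaPi tau t x = Th k t x.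

End Coefficients.

(* Main.v *)
Require Import Defs.
From HB Require Import structures.
From mathcomp Require Import all_boot all_order all_algebra.
From mathcomp Require Import all_classical all_reals all_analysis.
From mathcomp Require Import ring lra.
Import Order.TTheory GRing.Theory Num.Theory.
Import numFieldNormedType.Exports.
Local Open Scope classical_set_scope.
Local Open Scope ring_scope.

(** Fix tau in the k-th subinterval and put w(t, x) = Theta^k(t, x) -
    Theta(tau, t, x).  Subtracting the two equations gives
    w_t + tr(a w_xx) + F = 0, where |F| is bounded by a constant times the mesh
    plus |w|, |w_x| and the gaps of the values and gradients on the diagonal,
    through which the two controls differ (source_bound, gap_parabolic); at t = T
    both w and its Lipschitz constant in x are of the order of the mesh.  The
    theorem follows if F can be shown to contribute little to w and to w_x.

    This is done with the weight exp(lambda (T - t)) for a large lambda.  If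
    |F| <= A exp(lambda (T - t)), the maximum principle bounds w by
    (2 A / lambda + terminal data) exp(lambda (T - t)) (sup_estimate).  The
    gradient is estimated by doubling the variables (gradient_estimate):
    w(t, x) - w(t, y) is compared with exp(lambda (T - t)) phi(|x - y|), where
    phi(r) = al r - be r^2 is concave.  At a point where the comparison fails to hold, the second order
    conditions are tested in the pairs of directions (p_i, q_i), with p_i the
    columns of sigma(t, x) and q_i those of sigma(t, y) composed with the
    orthogonal reflection that turns p_i - q_i almost parallel to x - y
    (reflection_coupling).  The term phi'' then produces a negative
    contribution of the order of the ellipticity constant times be, which
    dominates F when be is proportional to A.  This gives a gradient bound
    proportional to A r1, where r1 is the range of |x - y| that has to be
    considered; r1 can be taken as small as desired once lambda is large,
    because the sup estimate takes over for |x - y| >= r1.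

    Hence, if all weighted gaps of values and gradients (over k, tau, t, x) are at
    most N, with N at least a constant times the mesh, they are in fact at most
    N / 2 (gap_halves), with constants that do not depend on the partition
    (contraction_constants).  Since the gaps are finite for each partition,
    iterating shows that they are at most a constant times the mesh
    (gap_iterate), uniformly on the whole domain. *)

(** * Euclidean geometry of columns and the reflection coupling *)

Section Euclid.
Context {R : realType}.

Lemma normr_mx_le {p q : nat} (A : 'M[R]_(p, q)) i j : `|A i j| <= `|A|.
Proof.
rewrite [leRHS]/Num.norm /= mx_normrE.
by apply/bigmax_geP; right => /=; exists (i, j).
Qed.

Lemma mx_normr_le {p q : nat} (A : 'M[R]_(p, q)) (c : R) :
  0 <= c -> (forall i j, `|A i j| <= c) -> `|A| <= c.
Proof.
move=> c0 Ac; rewrite [leLHS]/Num.norm /= mx_normrE.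
by apply/bigmax_leP; split => // -[i j] _; exact: Ac.
Qed.

Lemma innerC {n : nat} (u v : 'cV[R]_n) : inner u v = inner v u.
Proof. by apply: eq_bigr => i _; rewrite mulrC. Qed.

Lemma innerDl {n : nat} (u v w : 'cV[R]_n) :
  inner (u + v) w = inner u w + inner v w.
Proof. by rewrite -big_split; apply: eq_bigr => i _; rewrite mxE mulrDl. Qed.

Lemma innerZl {n : nat} k (u w : 'cV[R]_n) : inner (k *: u) w = k * inner u w.
Proof. by rewrite /inner mulr_sumr; apply: eq_bigr => i _; rewrite mxE mulrA. Qed.

Lemma innerNl {n : nat} (u w : 'cV[R]_n) : inner (- u) w = - inner u w.
Proof. by rewrite -scaleN1r innerZl mulN1r. Qed.

Lemma innerDr {n : nat} (u v w : 'cV[R]_n) :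
  inner w (u + v) = inner w u + inner w v.
Proof. by rewrite innerC innerDl !(innerC w). Qed.

Lemma innerZr {n : nat} k (u w : 'cV[R]_n) : inner w (k *: u) = k * inner w u.
Proof. by rewrite innerC innerZl (innerC w). Qed.

Lemma innerNr {n : nat} (u w : 'cV[R]_n) : inner w (- u) = - inner w u.
Proof. by rewrite innerC innerNl (innerC w). Qed.

Definition innerE := (@innerDl, @innerDr, @innerNl, @innerNr, @innerZl, @innerZr).

Lemma inner_mulmx {p q : nat} (A : 'M[R]_(p, q)) u v :
  inner (A *m u) v = inner u (A^T *m v).
Proof.
have innerM (k : nat) (x y : 'cV[R]_k) : inner x y = (x^T *m y) 0 0.
  by rewrite mxE; apply: eq_bigr => i _; rewrite mxE.
by rewrite !innerM trmx_mul mulmxA.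
Qed.

Lemma inner_ge0 {n : nat} (u : 'cV[R]_n) : 0 <= inner u u.
Proof. by apply: sumr_ge0 => i _; rewrite -expr2 sqr_ge0. Qed.

Lemma sqr_coord_le_inner {n : nat} (u : 'cV[R]_n) i : u i 0 ^+ 2 <= inner u u.
Proof.
rewrite /inner (bigD1 i)//= -expr2 lerDl.
by apply: sumr_ge0 => j _; rewrite -expr2 sqr_ge0.
Qed.

Lemma inner_eq0 {n : nat} (u : 'cV[R]_n) : inner u u = 0 -> u = 0.
Proof.
move=> u0; apply/matrixP => i j; rewrite (ord1 j) mxE.
apply/eqP; rewrite -sqrf_eq0 eq_le sqr_ge0 andbT -u0.
exact: sqr_coord_le_inner.
Qed.

Lemma inner_le_norm {n : nat} (u v : 'cV[R]_n) :
  `|inner u v| <= n%:R * (`|u| * `|v|).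
Proof.
apply: (le_trans (ler_norm_sum _ _ _)).
rewrite -[n in n%:R]card_ord -sum1_card natr_sum mulr_suml.
apply: ler_sum => i _; rewrite mul1r normrM.
by apply: ler_pM => //; exact: normr_mx_le.
Qed.

Lemma inner_parallelogram {n : nat} (u v : 'cV[R]_n) s :
  inner (u + s *: v) (u + s *: v) + inner (u - s *: v) (u - s *: v)
  = 2 * inner u u + 2 * (s ^+ 2 * inner v v).
Proof. by rewrite !innerE (innerC v u); ring. Qed.

Definition enorm {n : nat} (u : 'cV[R]_n) : R := Num.sqrt (inner u u).

Lemma enorm_ge0 {n : nat} (u : 'cV[R]_n) : 0 <= enorm u.
Proof. exact: sqrtr_ge0. Qed.

Lemma enorm_sqr {n : nat} (u : 'cV[R]_n) : enorm u ^+ 2 = inner u u.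
Proof. by rewrite sqr_sqrtr// inner_ge0. Qed.

Lemma norm_le_enorm {n : nat} (u : 'cV[R]_n) : `|u| <= enorm u.
Proof.
apply: mx_normr_le => [|i j]; first exact: enorm_ge0.
rewrite (ord1 j) -(@ler_pXn2r _ 2) ?nnegrE ?enorm_ge0//.
rewrite enorm_sqr real_normK ?num_real//; exact: sqr_coord_le_inner.
Qed.

Lemma enorm_eq0 {n : nat} (u : 'cV[R]_n) : enorm u = 0 -> u = 0.
Proof. by move=> u0; apply: inner_eq0; rewrite -enorm_sqr u0 expr0n. Qed.

(** Along a line the Euclidean norm curves only through the component of the
    direction orthogonal to the base point: writing m for the component of w
    along z, |z + s w| = sqrt((r + s m)^2 + s^2 (|w|^2 - m^2)), and the square
    root lies below its tangent at (r + s m)^2. *)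
Lemma enorm_second_difference {n : nat} {z w : 'cV[R]_n} {s : R} :
  0 < enorm z -> `|s| * `|inner w z| <= enorm z ^+ 2 / 2 ->
  enorm (z + s *: w) + enorm (z - s *: w) - 2 * enorm z
  <= 2 * s ^+ 2 * (inner w w - inner w z ^+ 2 / enorm z ^+ 2) / enorm z.
Proof.
set r := enorm z => r0 hs.
set P := inner w w - _.
have P0 : 0 <= P.
  have -> : P = inner (w - (inner w z / r ^+ 2) *: z)
                      (w - (inner w z / r ^+ 2) *: z).
    rewrite !innerE -[inner z z]enorm_sqr -/r (innerC z w) /P.
    by field; rewrite gt_eqF.
  exact: inner_ge0.
have half e : `|e| * `|inner w z| <= r ^+ 2 / 2 ->
  enorm (z + e *: w) <= r + e * (inner w z / r) + e ^+ 2 * P / r.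
  move=> he; have em : - (r / 2) <= e * (inner w z / r).
    have : `|e * (inner w z / r)| <= r / 2.
      rewrite mulrA !normrM normfV (gtr0_norm r0) ler_pdivrMr//.
      by apply: (le_trans he); rewrite expr2 -mulrA [_ / 2 * _]mulrC mulrA.
    by rewrite ler_norml => /andP[].
  have B0 : 0 <= r + e * (inner w z / r) + e ^+ 2 * P / r.
    apply: addr_ge0; first lra.
    by apply: mulr_ge0; rewrite ?invr_ge0 ?(ltW r0)// mulr_ge0// sqr_ge0.
  rewrite -(@ler_pXn2r _ 2) ?nnegrE ?enorm_ge0// enorm_sqr !innerE.
  rewrite -[inner z z]enorm_sqr -/r (innerC z w).
  rewrite -subr_ge0.
  set m := inner w z / r in em *.
  have -> : inner w z = m * r by rewrite /m divfK// gt_eqF.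
  have -> : inner w w = P + m ^+ 2 by rewrite /P /m; field; rewrite gt_eqF.
  have -> : (r + e * m + e ^+ 2 * P / r) ^+ 2 -
    (r ^+ 2 + e * (m * r) + (e * (m * r) + e * (e * (P + m ^+ 2)))) =
    e ^+ 2 * P * (2 * (r + e * m) / r - 1) + (e ^+ 2 * P / r) ^+ 2.
    by field; rewrite gt_eqF.
  apply: addr_ge0; last exact: sqr_ge0.
  apply: mulr_ge0; first by rewrite mulr_ge0// sqr_ge0.
  by rewrite subr_ge0 ler_pdivlMr// mul1r; lra.
have h1 := half s hs.
have h2 : enorm (z - s *: w) <= r - s * (inner w z / r) + s ^+ 2 * P / r.
  have := half (- s); rewrite normrN scaleNr mulNr sqrrN; exact.
have -> : 2 * s ^+ 2 * P / r = 2 * (s ^+ 2 * P / r) by rewrite !mulrA.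
lra.
Qed.

Definition frob2 {p q : nat} (A : 'M[R]_(p, q)) : R :=
  \sum_(i < q) inner (col i A) (col i A).

Lemma frob2_le {p q : nat} (A : 'M[R]_(p, q)) (c : R) :
  `|A| <= c -> frob2 A <= q%:R * (p%:R * c ^+ 2).
Proof.
move=> Ac; rewrite /frob2 -[q in q%:R]card_ord -sum1_card natr_sum mulr_suml.
apply: ler_sum => i _; rewrite mul1r.
rewrite /inner -[p in p%:R]card_ord -sum1_card natr_sum mulr_suml.
apply: ler_sum => j _; rewrite mul1r !mxE -expr2 -real_normK ?num_real//.
by rewrite ler_pXn2r ?nnegrE ?(le_trans (normr_mx_le _ _ _) Ac)// (le_trans _ Ac).
Qed.

Lemma frob2_tr {p q : nat} (A : 'M[R]_(p, q)) : frob2 A = \tr (A *m A^T).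
Proof.
rewrite mxtrace_mulC /mxtrace; apply: eq_bigr => i _; rewrite mxE.
by apply: eq_bigr => j _; rewrite !mxE.
Qed.

Lemma tr_gram_mul {p q : nat} (S : 'M[R]_(p, q)) (X : 'M[R]_p) :
  \tr ((2^-1 *: (S *m S^T)) *m X) =
  2^-1 * \sum_(i < q) inner (col i S) (X *m col i S).
Proof.
rewrite -scalemxAl mxtraceZ; congr (_ * _).
rewrite -mulmxA mxtrace_mulC -mulmxA; apply: eq_bigr => i _.
by rewrite mxE; apply: eq_bigr => j _; rewrite {2}colE mulmxA -colE !mxE.
Qed.

(** Replacing S' by Q = S' (1 - 2 zeta zeta^T / |zeta|^2),
    where S' zeta = 2 z, keeps S' S'^T; the columns of S - Q differ from those
    of S - S' by multiples of z only.  Hence they have a component along z that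
    does not vanish when S and S' get close, while their components orthogonal
    to z are still controlled by S - S'. *)
Lemma reflection_coupling {n d : nat} (S : 'M[R]_(n, d)) {S' : 'M[R]_(n, d)}
    {z : 'cV[R]_n} {lambda0 lambda1 : R} (a := 2^-1 *: (S' *m S'^T)) :
  0 < lambda0 -> 0 < lambda1 -> a \in unitmx ->
  loewner_le lambda0%:M (invmx a) -> loewner_le (invmx a) lambda1%:M ->
  0 < enorm z ->
  exists Q : 'M[R]_(n, d),
    [/\ Q *m Q^T = S' *m S'^T,
        forall i, inner (col i (S - Q)) (col i (S - Q))
          - inner (col i (S - Q)) z ^+ 2 / enorm z ^+ 2
          <= inner (col i (S - S')) (col i (S - S')) &
        4 / lambda1 - frob2 (S - S') <= frob2 (S - Q)].
Proof.
move=> l00 l10 aU al ar r0.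
have z2 : 0 < inner z z by rewrite -enorm_sqr exprn_gt0.
have SS : S' *m S'^T = 2 *: a by rewrite /a scalerA divff ?scale1r// pnatr_eq0.
pose zeta := S'^T *m (invmx a *m z).
have Sz : S' *m zeta = 2 *: z.
  by rewrite /zeta mulmxA SS -scalemxAl mulmxA mulmxV// mul1mx.
pose kap := inner zeta zeta.
have kapE : kap = 2 * inner z (invmx a *m z).
  by rewrite /kap {1}/zeta inner_mulmx trmxK Sz innerZr innerC.
have kap0 : 0 < kap.
  rewrite kapE mulr_gt0//; apply: (lt_le_trans _ (al z)).
  by rewrite mul_scalar_mx innerZr mulr_gt0.
have kap1 : kap <= 2 * lambda1 * inner z z.
  rewrite kapE -mulrA ler_pM2l//; apply: (le_trans (ar z)).
  by rewrite mul_scalar_mx innerZr.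
have zz : zeta^T *m zeta = kap%:M.
  apply/matrixP => i j; rewrite (ord1 i) (ord1 j) mxE [RHS]mxE /= mulr1n.
  by apply: eq_bigr => k _; rewrite mxE.
have [c cE] : exists c, c = 4 / kap by exists (4 / kap).
pose Q := S' - c *: (z *m zeta^T).
have WE i : col i (S - Q) = col i (S - S') + (c * zeta i 0) *: z.
  apply/matrixP => k j; rewrite (ord1 j) !mxE big_ord1 !mxE; ring.
exists Q; split.
- have -> : Q^T = S'^T - c *: (zeta *m z^T).
    by apply/matrixP => i j; rewrite !mxE !big_ord1 !mxE; ring.
  rewrite /Q.
  have e1 : S' *m (zeta *m z^T) = 2 *: (z *m z^T) by rewrite mulmxA Sz scalemxAl.
  have e2 : z *m zeta^T *m S'^T = 2 *: (z *m z^T).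
    by rewrite -mulmxA -trmx_mul Sz linearZ /= scalemxAr.
  have e3 : z *m zeta^T *m (zeta *m z^T) = kap *: (z *m z^T).
    by rewrite -mulmxA (mulmxA _ zeta) zz mul_scalar_mx scalemxAr.
  rewrite mulmxBl !mulmxBr -!scalemxAl -!scalemxAr e1 e2 e3 !scalerA.
  rewrite -!addrA -[RHS]addr0; congr (_ + _).
  rewrite opprB -![- (_ *: (_ *m _))]scaleNr -!scalerDl.
  rewrite -[RHS](scale0r (z *m z^T)); congr (_ *: _).
  by rewrite cE; field; rewrite gt_eqF.
- move=> i; rewrite WE; set D := col i (S - S'); set k := c * _.
  rewrite enorm_sqr !innerE (innerC z D) -subr_ge0.
  have -> : inner D D - (inner D D + k * inner D z
      + (k * inner D z + k * (k * inner z z))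
      - (inner D z + k * inner z z) ^+ 2 / inner z z)
    = inner D z ^+ 2 / inner z z by field; rewrite gt_eqF.
  by rewrite divr_ge0 ?sqr_ge0// ltW.
have lowW i : 2^-1 * (c * zeta i 0) ^+ 2 * inner z z
    - inner (col i (S - S')) (col i (S - S'))
    <= inner (col i (S - Q)) (col i (S - Q)).
  rewrite WE; set D := col i (S - S'); set k := c * _.
  have := inner_ge0 (2 *: D + k *: z).
  rewrite !innerE (innerC z D) => h; rewrite -subr_ge0.
  nra.
have {lowW} : \sum_(i < d) (2^-1 * (c * zeta i 0) ^+ 2 * inner z z
    - inner (col i (S - S')) (col i (S - S'))) <= frob2 (S - Q).
  by apply: ler_sum => i _; exact: lowW.
rewrite sumrB; apply: le_trans; rewrite lerD2r -mulr_suml -mulr_sumr.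
have -> : \sum_(i < d) (c * zeta i 0) ^+ 2 = c ^+ 2 * kap.
  rewrite /kap /inner mulr_sumr; apply: eq_bigr => i _.
  by rewrite exprMn -expr2.
have -> : 2^-1 * (c ^+ 2 * kap) * inner z z = 8 * inner z z / kap.
  by rewrite cE; field; rewrite gt_eqF.
rewrite ler_pdivlMr// mulrAC ler_pdivrMr//; nra.
Qed.

End Euclid.

(** * Lipschitz bounds and second differences *)

Section DifferentialCalculus.
Context {R : realType}.

(** The supremum defining dnorm is over a bounded set because the differential
    is continuous; homogeneity then removes the restriction to the unit ball. *)
Lemma dnorm_bound {V W : normedModType R} (f : V -> W) x K v :
  differentiable f x -> dnorm f x <= K -> `|'d f x v| <= K * `|v|.
Proof.
move=> df dK.
have [k k0 hk] := linear_lipschitz (diff_continuous df).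
have ub u : `|u| <= 1 -> `|'d f x u| <= K.
  move=> u1; apply: le_trans dK; apply: ub_le_sup; last by exists u.
  exists k => _ [y /= y1 <-]; apply: (le_trans (hk y)).
  by rewrite ler_piMr// ltW.
have [->|v0] := eqVneq v 0; first by rewrite linear0 !normr0 mulr0.
have nv : 0 < `|v| by rewrite normr_gt0.
rewrite -ler_pdivrMr//.
have -> : `|'d f x v| / `|v| = `|'d f x (`|v|^-1 *: v)|.
  by rewrite linearZ normrZ normfV normr_id mulrC.
by apply: ub; rewrite normrZ normfV normr_id mulVf// gt_eqF.
Qed.

Lemma dnorm_ge0 {V W : normedModType R} (f : V -> W) x :
  differentiable f x -> 0 <= dnorm f x.
Proof.
move=> df; have [k k0 hk] := linear_lipschitz (diff_continuous df).
apply: ub_le_sup; last by exists 0; rewrite /= ?normr0 ?ler01// linear0 normr0.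
exists k => _ [y /= y1 <-]; apply: (le_trans (hk y)).
by rewrite ler_piMr// ltW.
Qed.

Lemma is_derive_line {V W : normedModType R} (f : V -> W) (x p : V) (s : R) :
  differentiable f (x + s *: p) ->
  is_derive s (1:R) (fun s : R => f (x + s *: p)) ('d f (x + s *: p) p).
Proof.
move=> df.
have daff : is_diff s (fun s : R => x + s *: p) (fun s : R => s *: p).
  have := @is_diffD _ _ _ _ _ _ _ s (is_diff_cst x s) (is_diff_scalel s p).
  by move=> h; apply: (is_diff_eq h); apply/funext => u; rewrite /= add0r.
have dc : differentiable (f \o (fun s : R => x + s *: p)) s.
  exact: differentiable_comp.
apply: DeriveDef; first exact: diff_derivable.
have := deriveE (1 : R) dc; rewrite diff_comp//= => ->.
by rewrite diff_val scale1r.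
Qed.

Lemma lipschitz_scalar {V : normedModType R} (f : V -> R) (K : R) :
  (forall x, differentiable f x) -> (forall x v, `|'d f x v| <= K * `|v|) ->
  forall x y, `|f x - f y| <= K * `|x - y|.
Proof.
move=> df dK x y.
pose k s := f (y + s *: (x - y)).
have dk (s : R) : is_derive s (1:R) k ('d f (y + s *: (x - y)) (x - y)).
  exact/is_derive_line/df.
have ck : {within `[0, 1], continuous k}.
  apply: continuous_subspaceT => s.
  by apply/differentiable_continuous/derivable1_diffP; case: (dk s).
have [c _] := MVT ltr01 (fun s _ => dk s) ck.
by rewrite /k scale1r scale0r addr0 addrCA subrr addr0 subr0 mulr1 => ->.
Qed.

Lemma lipschitz_mx {V : normedModType R} {p q : nat} (f : V -> 'M[R]_(p, q))
    (K : R) : 0 <= K ->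
  (forall x, differentiable f x) -> (forall x v, `|'d f x v| <= K * `|v|) ->
  forall x y, `|f x - f y| <= K * `|x - y|.
Proof.
move=> K0 df dK x y; apply: mx_normr_le => [|i j]; first exact: mulr_ge0.
have dc z : differentiable (fun M : 'M[R]_(p, q) => M i j : R) z.
  exact: differentiable_coord.
have dcE z v : 'd (fun M : 'M[R]_(p, q) => M i j : R) z v = v i j.
  have lin : linear (fun M : 'M[R]_(p, q) => M i j : R).
    by move=> a M N; rewrite !mxE.
  pose LM := GRing.isLinear.Build _ _ _ _ _ lin.
  pose L : {linear _ -> _} := HB.pack (fun M : 'M[R]_(p, q) => M i j : R) LM.
  have -> : (fun M : 'M[R]_(p, q) => M i j : R) = L by [].
  by rewrite diff_lin//; exact: coord_continuous.
have := @lipschitz_scalar V (fun z => f z i j) K.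
rewrite !mxE; apply => [z|z v].
  exact: (differentiable_comp (df z) (dc (f z))).
have -> : (fun z => f z i j) = (fun M : 'M[R]_(p, q) => M i j) \o f by [].
rewrite diff_comp//= dcE; apply: le_trans (dK z v).
exact: normr_mx_le.
Qed.

Lemma C1b_on_lipschitz_scalar {V : normedModType R} {A : set V} {f : V -> R} :
  C1b_on A f ->
  exists2 K, 0 <= K & forall x y, A x -> A y -> `|f x - f y| <= K * `|x - y|.
Proof.
move=> [F [FE dF _ _ [K FK]]].
have K0 : 0 <= K by apply: le_trans (FK 0); exact: dnorm_ge0.
exists K => // x y Ax Ay; rewrite -!FE//.
by apply: lipschitz_scalar => // z v; exact: dnorm_bound.
Qed.

Lemma C1b_on_lipschitz_mx {V : normedModType R} {p q : nat} {A : set V}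
    {f : V -> 'M[R]_(p, q)} :
  C1b_on A f ->
  exists2 K, 0 <= K & forall x y, A x -> A y -> `|f x - f y| <= K * `|x - y|.
Proof.
move=> [F [FE dF _ _ [K FK]]].
have K0 : 0 <= K by apply: le_trans (FK 0); exact: dnorm_ge0.
exists K => // x y Ax Ay; rewrite -!FE//.
by apply: lipschitz_mx => // z v; exact: dnorm_bound.
Qed.

Lemma C1b_on_bounded {V W : normedModType R} {A : set V} {f : V -> W} :
  C1b_on A f -> exists2 M, 0 <= M & forall x, A x -> `|f x| <= M.
Proof.
move=> [F [FE _ _ [M FM] _]]; exists M => [|x Ax]; last by rewrite -FE// FM.
exact: le_trans (FM 0 _).
Qed.

Lemma diff_grad {n : nat} (f : 'cV[R]_n -> R) x p :
  'd f x p = inner (grad f x) p.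
Proof.
have {1}-> : p = \sum_(i < n) p i 0 *: delta_mx i 0.
  by rewrite {1}(matrix_sum_delta p); apply: eq_bigr => i _; rewrite big_ord1.
rewrite linear_sum; apply: eq_bigr => i _.
by rewrite linearZ /= mxE mulrC.
Qed.

Lemma diff_grad_hess {n : nat} (f : 'cV[R]_n -> R) x p :
  'd (grad f) x p = hess f x *m p.
Proof.
have {1}-> : p = \sum_(i < n) p i 0 *: delta_mx i 0.
  by rewrite {1}(matrix_sum_delta p); apply: eq_bigr => i _; rewrite big_ord1.
rewrite linear_sum /=; apply/matrixP => i j; rewrite (ord1 j) summxE mxE.
by apply: eq_bigr => k _; rewrite linearZ !mxE /= mulrC.
Qed.

Lemma norm_grad_le {n : nat} (f : 'cV[R]_n -> R) x c :
  0 <= c -> differentiable f x ->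
  (forall y, `|f y - f x| <= c * enorm (y - x)) -> `|grad f x| <= c.
Proof.
move=> c0 df fc; apply: mx_normr_le => // i j; rewrite mxE -deriveE//.
set v : 'cV[R]_n := delta_mx i 0.
have v1 : enorm v = 1.
  rewrite /enorm /inner (bigD1 i)//= big1 ?addr0 => [|k ki].
    by rewrite !mxE !eqxx mulr1 sqrtr1.
  by rewrite !mxE (negbTE ki) mul0r.
have dv : derivable f x v by exact: diff_derivable.
have hcvg := cvg_norm dv.
rewrite /derive; apply: (cvgr_to_le (hcvg _)).
near=> h.
have h0 : h != 0 by near: h; exact: nbhs_dnbhs_neq.
rewrite /= normrM normfV ler_pdivrMl ?normr_gt0//.
apply: (le_trans (fc _)); rewrite addrK mulrC ler_wpM2r//.
rewrite /enorm !innerE mulrA -expr2 sqrtrM ?sqr_ge0// sqrtr_sqr.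
by rewrite -/(enorm v) v1 mulr1.
Unshelve. all: by end_near. Qed.

Lemma is_diff_inner {n : nat} (p u : 'cV[R]_n) :
  is_diff u (fun v : 'cV[R]_n => inner v p : R) (fun v => inner v p).
Proof.
have lin : linear (fun v : 'cV[R]_n => inner v p : R).
  by move=> a v w; rewrite innerDl innerZl.
pose LM := GRing.isLinear.Build _ _ _ _ _ lin.
pose L : {linear _ -> _} := HB.pack (fun v : 'cV[R]_n => inner v p : R) LM.
have -> : (fun v : 'cV[R]_n => inner v p : R) = L by [].
have cL : continuous L.
  apply/linear_bounded_continuous/bounded_funP => r.
  exists (n%:R * (r * `|p|)) => v vr; apply: (le_trans (inner_le_norm _ _)).
  by rewrite ler_wpM2l// ler_wpM2r.
by apply: DiffDef; [exact: linear_differentiable|rewrite diff_lin].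
Qed.

(** The mean value theorem applied to f(x + s p) + f(x - s p) - s^2 (p, H p)
    reduces the second difference quotient to the first order expansion of the
    gradient at x. *)
Lemma second_difference_cvg {n : nat} (f : 'cV[R]_n -> R) x p :
  (forall y, differentiable f y) -> differentiable (grad f) x ->
  (f (x + s *: p) + f (x - s *: p) - 2 * f x) / s ^+ 2 @[s --> (0 : R)^'+]
    --> inner p (hess f x *m p).
Proof.
move=> df dg; set q := inner p _.
pose k s := inner (grad f (x + s *: p)) p.
have dk : is_derive (0 : R) (1:R) k q.
  have := @is_derive_line _ _ ((fun v => inner v p : R) \o grad f) x p 0.
  rewrite scale0r addr0 diff_comp//=; last first.
    by have [] := is_diff_inner p (grad f x).
  rewrite (@diff_val _ _ _ _ _ _ _ (is_diff_inner p (grad f x))) diff_grad_hess.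
  rewrite innerC; apply; apply: differentiable_comp => //.
  by have [] := is_diff_inner p (grad f x).
have [g [gE gc g0]] := (is_derive1_caratheodory _ _ _).1 dk.
pose G (s : R) := f (x + s *: p) + f (x - s *: p) - s ^+ 2 * q.
have dG (s : R) : is_derive s (1:R) G (k s - k (- s) - 2 * s * q).
  have d1 : is_derive s (1:R) (fun s : R => f (x + s *: p)) (k s).
    by rewrite /k -diff_grad; exact: is_derive_line.
  have d2 : is_derive s (1:R) (fun s : R => f (x - s *: p)) (- k (- s)).
    have -> : (fun s : R => f (x - s *: p)) = (fun s : R => f (x + s *: (- p))).
      by apply/funext => u; rewrite scalerN.
    have -> : - k (- s) = inner (grad f (x + s *: (- p))) (- p).
      have e : (- s) *: p = s *: (- p) by rewrite scaleNr scalerN.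
      by rewrite (innerNr p (grad f _)) /k e.
    by rewrite -diff_grad; exact: is_derive_line.
  have d3 : is_derive s (1:R) (fun s : R => s ^+ 2 * q) (2 * s * q).
    apply: is_derive_eq; rewrite scaler0 add0r /GRing.scale /= mulr1.
    by ring.
  have := @is_deriveB _ _ _ _ _ _ _ _ _ (@is_deriveD _ _ _ _ _ _ _ _ _ d1 d2) d3.
  exact.
apply/cvgrPdist_le => e e0.
have gnear : \forall s \near (0 : R), `|g s - q| <= e / 2.
  have gq : g @ (0 : R) --> q by rewrite -g0; exact: gc.
  move/cvgrPdist_le : gq => /(_ (e / 2)).
  by rewrite divr_gt0// => /(_ isT); apply: filterS => s; rewrite distrC.
have [dl /= dl0 hdl] := gnear.
near=> s.
have s0 : 0 < s by near: s; exact: nbhs_right_gt.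
have sdl : s < dl by near: s; exact: nbhs_right_lt.
have Gc : {within `[0, s], continuous G}.
  apply: continuous_subspaceT => u.
  by apply/differentiable_continuous/derivable1_diffP; case: (dG u).
have [c /[!in_itv]/= /andP[c0 cs] GE] := MVT s0 (fun u _ => dG u) Gc.
have kE u : k u = k 0 + g u * u.
  by have := gE u; rewrite (subr0 u) => <-; rewrite addrC subrK.
have {GE} GE : f (x + s *: p) + f (x - s *: p) - 2 * f x - s ^+ 2 * q =
    ((g c - q) + (g (- c) - q)) * c * s.
  have G0 : G 0 = 2 * f x.
    by rewrite /G scale0r addr0 subr0 expr0n /= mul0r subr0; ring.
  have -> : f (x + s *: p) + f (x - s *: p) - 2 * f x - s ^+ 2 * q = G s - G 0.
    by rewrite G0 /G; ring.
  by rewrite GE (kE c) (kE (- c)) (subr0 s); clear; move: (k 0) => k0; ring.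
have gs u : `|u| < dl -> `|g u - q| <= e / 2.
  by move=> ul; apply: hdl; rewrite /= sub0r normrN.
have g1 : `|g c - q| <= e / 2 by apply: gs; rewrite gtr0_norm// (lt_trans cs).
have g2 : `|g (- c) - q| <= e / 2.
  by apply: gs; rewrite normrN gtr0_norm// (lt_trans cs).
rewrite distrC.
have -> : (f (x + s *: p) + f (x - s *: p) - 2 * f x) / s ^+ 2 - q
   = (f (x + s *: p) + f (x - s *: p) - 2 * f x - s ^+ 2 * q) / s ^+ 2.
  by field; rewrite gt_eqF.
rewrite GE !normrM normfV (gtr0_norm c0) (gtr0_norm s0).
rewrite (gtr0_norm (exprn_gt0 _ s0)) ler_pdivrMr ?exprn_gt0//.
have h : `|g c - q + (g (- c) - q)| <= e.
  by apply: (le_trans (ler_normD _ _)); lra.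
rewrite expr2 mulrA; apply: ler_wpM2r; first exact: ltW.
by apply: ler_pM => //; exact: ltW.
Unshelve. all: by end_near. Qed.

Lemma tderiv_right {I : set R} {f : R -> R} {t} (t' : R) :
  tderivable I f t -> t < t' -> (forall s, t < s < t' -> I s) ->
  (f s - f t) / (s - t) @[s --> t^'+] --> tderiv I f t.
Proof.
move=> hc tt' sub; apply: cvg_trans hc; apply: cvg_app => A hA.
have hA' : \forall s \near t, s != t -> I s -> A s by exact: hA.
have near_lt : \forall s \near t, s < t' by exact: lt_nbhsl.
suff : \forall s \near t, t < s -> A s by [].
move: hA' near_lt; apply: filterS2 => s /= hs st' ts.
by apply: hs; [rewrite gt_eqF|apply: sub; rewrite ts].
Qed.

Lemma tderiv_interior {a b : R} {f : R -> R} {t : R} :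
  tderivable `[a, b] f t -> a < t < b ->
  is_derive t (1 : R) f (tderiv `[a, b] f t).
Proof.
move=> hc /andP[at_ tb]; set D := tderiv _ _ _.
apply/is_derive1_caratheodory.
exists (fun z => if z == t then D else (f z - f t) / (z - t)); split.
- move=> z; case: eqP => [->|/eqP]; first by rewrite !subrr mulr0.
  by rewrite -subr_eq0 => /divfK->.
- apply/continuous_withinNx; rewrite eqxx.
  apply: (@cvg_trans _ ((fun z => (f z - f t) / (z - t)) @ t^')).
    apply: near_eq_cvg; near=> z.
    suff -> : (z == t) = false by [].
    by apply/negbTE; near: z; exact: nbhs_dnbhs_neq.
  apply: cvg_trans hc; apply: cvg_app => A hA.
  have hA' : \forall s \near t, s != t -> `[a, b]%classic s -> A s by exact: hA.
  suff : \forall s \near t, s != t -> A s by [].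
  move: hA' (lt_nbhsr at_) (lt_nbhsl tb); apply: filterS3 => s hs as_ sb st.
  by apply: hs => //; rewrite /= in_itv/= !ltW.
- by rewrite eqxx.
Unshelve. all: by end_near. Qed.

Lemma is_derive_lipschitz (a b : R) (f df : R -> R) (K : R) :
  {within `[a, b], continuous f} ->
  (forall t, a < t < b -> is_derive t (1 : R) f (df t)) ->
  (forall t, a < t < b -> `|df t| <= K) ->
  forall s t, a <= s -> s <= t -> t <= b -> `|f t - f s| <= K * (t - s).
Proof.
move=> cf dfP dfK s t as_ st tb.
move: st; rewrite le_eqVlt => /orP[/eqP->|st]; first by rewrite !subrr normr0 mulr0.
have sub u : u \in `]s, t[%R -> a < u < b.
  rewrite in_itv/= => /andP[su ut].
  by rewrite (le_lt_trans as_ su) (lt_le_trans ut tb).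
have cst : {within `[s, t], continuous f}.
  apply: continuous_subspaceW cf => u /=; rewrite !in_itv/= => /andP[su ut].
  by rewrite (le_trans as_ su) (le_trans ut tb).
have [c /sub cab ->] := MVT st (fun u hu => dfP u (sub u hu)) cst.
rewrite normrM (@gtr0_norm _ (t - s)) ?subr_gt0//.
by apply: ler_wpM2r; [rewrite subr_ge0 ltW|exact: dfK].
Qed.

End DifferentialCalculus.

(** * Maximum points and parabolic inequalities *)

Section MaximumPrinciple.
Context {R : realType}.

Lemma compact_cV_ball {n : nat} (c : R) : compact [set x : 'cV[R]_n | `|x| <= c].
Proof.
have trc : continuous (@trmx R 1 n).
  move=> M s /= /(nbhs_ballP (M^T)) [e e0 es].
  apply/nbhs_ballP; exists e => //= N [e0' MN]; apply: es; split => // i j.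
  by rewrite !mxE; exact: MN.
have -> : [set x : 'cV[R]_n | `|x| <= c]
    = @trmx R 1 n @` [set v : 'rV[R]_n | `|v| <= c].
  have trn (p q : nat) (M : 'M[R]_(p, q)) : `|M^T| <= `|M|.
    by apply: mx_normr_le => // i j; rewrite mxE; exact: normr_mx_le.
  apply/seteqP; split => [x /= xc|_ [v /= vc <-]].
    by exists x^T; rewrite ?trmxK//=; exact: le_trans (trn _ _ _) xc.
  exact: le_trans (trn _ _ _) vc.
apply: continuous_compact; first exact: continuous_subspaceT.
apply: bounded_closed_compact.
  exists c; split; first exact: num_real.
  by move=> M cM v /= /le_trans; apply; exact: ltW.
apply: (closed_comp (f := fun v : 'rV[R]_n => `|v|) (D := [set y | y <= c])).
  by move=> v _; exact: norm_continuous.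
exact: closed_le.
Qed.

Lemma inner_continuous {n : nat} : continuous (fun x : 'cV[R]_n => inner x x).
Proof.
rewrite /inner; apply: continuous_big => [|i _].
  exact: add_continuous.
move=> x; apply: differentiable_continuous.
by apply: differentiableM; exact: differentiable_coord.
Qed.

Lemma enorm_continuous {n : nat} : continuous (@enorm R n).
Proof.
move=> x; apply: continuous_comp; first exact: inner_continuous.
exact: sqrt_continuous.
Qed.

(** A bounded function that is positive somewhere need not attain its supremum
    over the unbounded space.  Subtracting eta (|x|^2 + |y|^2) restores
    attainment, at the cost of a small positive bound on the second
    differences. *)
Lemma penalized_max {n : nat} {T s0 B eta : R}
    {u : R -> 'cV[R]_n -> 'cV[R]_n -> R} {t0 x0 y0} :
  {within `[s0, T] `*` setT `*` setT, continuous (unc3 u)} -> 0 < eta ->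
  (forall t x y, s0 <= t <= T -> u t x y <= B) ->
  s0 <= t0 <= T -> eta * (inner x0 x0 + inner y0 y0) < u t0 x0 y0 ->
  exists t x y, [/\ s0 <= t <= T, 0 < u t x y,
    forall s, s0 <= s <= T -> u s x y <= u t x y &
    forall p q, u t (x + p) (y + q) + u t (x - p) (y - q) - 2 * u t x y
      <= 2 * eta * (inner p p + inner q q)].
Proof.
move=> cu eta0 uB ht0 u0.
pose N (x y : 'cV[R]_n) := inner x x + inner y y.
have N0 x y : 0 <= N x y by apply: addr_ge0; exact: inner_ge0.
have B0 : 0 < B.
  apply: lt_le_trans (uB t0 x0 y0 ht0); apply: le_lt_trans u0.
  by apply: mulr_ge0; [exact: ltW|exact: N0].
pose c := Num.sqrt (B / eta).
have cE : c ^+ 2 = B / eta by rewrite sqr_sqrtr// divr_ge0// ltW.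
pose K : set (R * 'cV[R]_n * 'cV[R]_n) :=
  `[s0, T] `*` [set x : 'cV[R]_n | `|x| <= c] `*` [set y : 'cV[R]_n | `|y| <= c].
have cK : compact K.
  apply: compact_setX; last exact: compact_cV_ball.
  by apply: compact_setX; [exact: segment_compact|exact: compact_cV_ball].
pose v := fun q => unc3 u q - eta * (inner q.1.2 q.1.2 + inner q.2 q.2).
have cv : {within K, continuous v}.
  move=> q; apply: cvgB.
    apply: (continuous_subspaceW _ cu) => q' [[? ?] ?].
    by split.
  have cN : continuous (fun q : R * 'cV[R]_n * 'cV[R]_n =>
      eta * (inner q.1.2 q.1.2 + inner q.2 q.2)).
    move=> q'; apply: cvgM; first exact: cvg_cst.
    apply: cvgD.
      apply: (continuous_comp (f := fun q : R * 'cV[R]_n * 'cV[R]_n => q.1.2)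
        (g := fun x : 'cV[R]_n => inner x x)); last exact: inner_continuous.
      by apply: continuous_comp; [exact: cvg_fst|exact: cvg_snd].
    apply: (continuous_comp (f := fun q : R * 'cV[R]_n * 'cV[R]_n => q.2)
        (g := fun x : 'cV[R]_n => inner x x)); last exact: inner_continuous.
    exact: cvg_snd.
  exact: (continuous_subspaceT cN).
have inK t x y : s0 <= t <= T -> 0 < u t x y - eta * N x y -> K (t, x, y).
  move=> ht h.
  have hN : N x y < c ^+ 2.
    rewrite cE ltr_pdivlMr// mulrC -subr_gt0; apply: (lt_le_trans h).
    by rewrite lerD2r; exact: uB.
  have lec z : inner z z <= N x y -> `|z : 'cV[R]_n| <= c.
    move=> zN; apply: (le_trans (norm_le_enorm z)).
    rewrite -(@ler_pXn2r _ 2) ?nnegrE ?enorm_ge0 ?sqrtr_ge0// enorm_sqr.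
    exact: le_trans zN (ltW hN).
  split; first split => /=; first by rewrite in_itv.
    by apply: lec; rewrite lerDl inner_ge0.
  by apply: lec => /=; rewrite lerDr inner_ge0.
have u0' : 0 < u t0 x0 y0 - eta * N x0 y0 by rewrite subr_gt0.
have K0 : K !=set0 by exists (t0, x0, y0); exact: inK.
have [[[t x] y] /set_mem [[/= ht _] _] hmax] := compact_EVT_max K0 cK cv.
rewrite in_itv/= in ht.
have {}hmax s x' y' : s0 <= s <= T ->
    u s x' y' - eta * N x' y' <= u t x y - eta * N x y.
  move=> hs; have pos : 0 < u t x y - eta * N x y.
    apply: (lt_le_trans u0'); apply: (hmax (t0, x0, y0)).
    by apply: mem_set; exact: inK.
  have [h|h] := leP (u s x' y' - eta * N x' y') 0.
    exact: le_trans h (ltW pos).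
  by apply: (hmax (s, x', y')); apply: mem_set; exact: inK.
exists t, x, y; split => //.
- have := hmax t0 x0 y0 ht0; have := mulr_ge0 (ltW eta0) (N0 x y); lra.
- by move=> s hs; have := hmax s x y hs; lra.
- move=> p q; have h1 := hmax t (x + p) (y + q) ht.
  have h2 := hmax t (x - p) (y - q) ht.
  have NE : N (x + p) (y + q) + N (x - p) (y - q)
      = 2 * N x y + 2 * (inner p p + inner q q).
    rewrite /N !innerE (innerC p x) (innerC q y); ring.
  have : eta * (N (x + p) (y + q) + N (x - p) (y - q)) =
      2 * (eta * N x y) + 2 * eta * (inner p p + inner q q) by rewrite NE; ring.
  lra.
Qed.

(** The weight exp(- lambda (T - t)) turns a maximum in time into a decay
    rate of order lambda. *)
Lemma weighted_right_derivative {T lambda t D : R} {f : R -> R} :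
  0 < lambda -> t < T -> 0 <= f t ->
  (f s - f t) / (s - t) @[s --> t^'+] --> D ->
  (forall s, t <= s <= T -> expR (- (lambda * (T - s))) * f s
     <= expR (- (lambda * (T - t))) * f t) ->
  D <= - (lambda / 2) * f t.
Proof.
move=> l0 tT ft0 hD hmax; apply: (cvgr_to_le hD); near=> s.
have ts : t < s by near: s; exact: nbhs_right_gt.
have sT : s < T by near: s; exact: nbhs_right_lt.
have st1 : s - t < lambda^-1.
  by near: s; apply: nbhs_right_ltDr; rewrite invr_gt0.
rewrite ler_pdivrMr ?subr_gt0//.
set y := lambda * (s - t).
have y0 : 0 < y by rewrite mulr_gt0 ?subr_gt0.
have y1 : y <= 1 by rewrite /y mulrC -ler_pdivlMr// div1r ltW.
have fs : f s <= expR (- y) * f t.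
  have := hmax s; rewrite (ltW ts) (ltW sT) => /(_ isT).
  have -> : - (lambda * (T - t)) = - (lambda * (T - s)) + - y by rewrite /y; ring.
  by rewrite expRD -mulrA ler_pM2l// expR_gt0.
have ey : expR (- y) <= 1 - y / 2.
  have := expR_ge1Dx y; have := expRxMexpNx_1 y; have := expR_gt0 (- y).
  move: (expR y) (expR (- y)) => a b b0 ab ya.
  have : (1 + y) * b <= a * b by rewrite ler_wpM2r// ltW.
  nra.
have : expR (- y) * f t <= (1 - y / 2) * f t by rewrite ler_wpM2r.
rewrite /y; lra.
Unshelve. all: by end_near. Qed.

(** X plays the Hessian of w(t, .) at x and D the right time derivative; they
    are characterized by difference quotients, which is all that the maximum
    principle tests and which makes the predicate stable under negation. *)
Definition parabolic_bound {n d : nat} (sigma : R -> 'cV[R]_n -> 'M[R]_(n, d))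
    (T s0 lambda A : R) (w : R -> 'cV[R]_n -> R) :=
  forall t x, s0 <= t -> t < T -> exists D X,
    [/\ (w s x - w t x) / (s - t) @[s --> t^'+] --> D,
        forall p, (w t (x + s *: p) + w t (x - s *: p) - 2 * w t x) / s ^+ 2
          @[s --> (0 : R)^'+] --> inner p (X *m p) &
        `|D + \tr (acoef sigma t x *m X)| <= A * expR (lambda * (T - t))].

Lemma parabolic_boundN {n d : nat} (sigma : R -> 'cV[R]_n -> 'M[R]_(n, d))
    T s0 lambda A w : parabolic_bound sigma T s0 lambda A w ->
  parabolic_bound sigma T s0 lambda A (fun t x => - w t x).
Proof.
move=> hw t x st tT; have [D [X [hD hX hA]]] := hw t x st tT.
exists (- D), (- X); split.
- have -> : (fun s => (- w s x - - w t x) / (s - t))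
      = (fun s => - ((w s x - w t x) / (s - t))).
    by apply/funext => s; rewrite -[RHS]mulNr; congr (_ / _); ring.
  exact: cvgN.
- move=> p; have -> : inner p (- X *m p) = - inner p (X *m p).
    by rewrite mulNmx innerNr.
  have -> : (fun s : R => (- w t (x + s *: p) + - w t (x - s *: p)
        - 2 * - w t x) / s ^+ 2)
      = (fun s => - ((w t (x + s *: p) + w t (x - s *: p) - 2 * w t x) / s ^+ 2)).
    by apply/funext => s; rewrite -[RHS]mulNr; congr (_ / _); ring.
  exact: cvgN (hX p).
- by rewrite mulmxN linearN /= -opprD normrN.
Qed.

Lemma second_difference_le {G : R -> R} {q c : R} :
  G s / s ^+ 2 @[s --> (0 : R)^'+] --> q ->
  (\forall s \near (0 : R)^'+, G s <= c * s ^+ 2) -> q <= c.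
Proof.
move=> hq hG; apply: (cvgr_to_le hq); near=> s.
have s0 : 0 < s by near: s; exact: nbhs_right_gt.
rewrite ler_pdivrMr ?exprn_gt0//; near: s; exact: hG.
Unshelve. all: by end_near. Qed.

End MaximumPrinciple.

(** * Sup and gradient estimates by the maximum principle *)

Section GradientEstimate.
Context {R : realType} {n d : nat}.
Variables (sigma : R -> 'cV[R]_n -> 'M[R]_(n, d)) (T s0 lambda A om Cs B : R).
Hypotheses (l0 : 0 < lambda) (A0 : 0 < A) (om0 : 0 < om) (Cs0 : 0 < Cs).
Hypothesis frob_bound : forall t x, s0 <= t <= T -> frob2 (sigma t x) <= Cs.

Let E (t : R) := expR (lambda * (T - t)).

Let E0 t : 0 < E t. Proof. exact: expR_gt0. Qed.

Let expRE t : expR (- (lambda * (T - t))) = (E t)^-1.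
Proof. by rewrite expRN. Qed.

Lemma weight_le1 {t} : t <= T -> 0 < expR (- (lambda * (T - t))) <= 1.
Proof.
move=> tT; rewrite expR_gt0 /= -expR0 ler_expR oppr_le0.
by rewrite mulr_ge0 ?subr_ge0// ltW.
Qed.

Lemma exists_small_factor {a b c : R} : 0 <= a -> 0 <= b -> 0 < c ->
  exists eta, [/\ 0 < eta, eta * a < c & eta * b < c].
Proof.
move=> a0 b0 c0; have ab1 : 0 < a + b + 1 by lra.
exists (c / (a + b + 1)); split; first exact: divr_gt0.
  by rewrite mulrAC ltr_pdivrMr// ltr_pM2l//; lra.
by rewrite mulrAC ltr_pdivrMr// ltr_pM2l//; lra.
Qed.

(** The test functions of both estimates have this shape, with k = 0 and
   k = 1. *)
Lemma doubled_test_continuous (w : R -> 'cV[R]_n -> R)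
    (Psi : 'cV[R]_n -> 'cV[R]_n -> R) :
  {within `[s0, T] `*` setT, continuous (unc2 w)} ->
  continuous (fun q : 'cV[R]_n * 'cV[R]_n => Psi q.1 q.2) ->
  forall k, {within `[s0, T] `*` setT `*` setT, continuous (unc3 (fun t x y =>
    expR (- (lambda * (T - t))) * (w t x - k * w t y) - Psi x y))}.
Proof.
move=> /subspace_continuousP cw cPsi k; apply/subspace_continuousP.
move=> [[t x] y] /= [[/= ht _] _].
have c1 : q.1.1 @[q --> nbhs (t, x, y)] --> t.
  by apply: (cvg_comp fst fst); [exact: cvg_fst|exact: cvg_fst].
have c2 : q.1.2 @[q --> nbhs (t, x, y)] --> x.
  by apply: (cvg_comp fst snd); [exact: cvg_fst|exact: cvg_snd].
have c3 : q.2 @[q --> nbhs (t, x, y)] --> y by exact: cvg_snd.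
have cvt : (fun q : R * 'cV[R]_n * 'cV[R]_n => q.1.1) @
    within (`[s0, T] `*` setT `*` setT) (nbhs (t, x, y)) --> t.
  exact: (cvg_within_filter _ c1).
have cvw (pi : R * 'cV[R]_n * 'cV[R]_n -> R * 'cV[R]_n) :
    {for (t, x, y), continuous pi} ->
    (forall q, (pi q).1 = q.1.1) ->
    unc2 w (pi q) @[q --> within (`[s0, T] `*` setT `*` setT) (nbhs (t, x, y))]
      --> unc2 w (pi (t, x, y)).
  move=> cpi pi1.
  have h : pi @ within (`[s0, T] `*` setT `*` setT) (nbhs (t, x, y))
      --> within (`[s0, T] `*` setT) (nbhs (pi (t, x, y))).
    move=> P /= hP; have := cpi _ hP; rewrite /= /within /=.
    rewrite !nbhs_simpl /=; apply: filterS => q hq [[hq1 _] _].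
    by apply: hq; split => //=; rewrite pi1.
  apply: (cvg_comp _ _ h); apply: cw; split => //=.
  by rewrite pi1.
apply: cvgB; first apply: cvgM.
- have cE : continuous (fun s : R => expR (- (lambda * (T - s)))).
    move=> s; apply: (continuous_comp (f := fun s : R => - (lambda * (T - s)))).
      apply: continuousN; apply: continuousM; first exact: cvg_cst.
      by apply: continuousB; [exact: cvg_cst|exact: cvg_id].
    exact: continuous_expR.
  exact: (cvg_comp _ _ cvt (cE t)).
- apply: cvgB.
    apply: (cvw (fun q => q.1)) => //; exact: cvg_fst.
  apply: cvgM; first exact: cvg_cst.
  apply: (cvw (fun q => (q.1.1, q.2))) => //.
  exact: (cvg_pair c1 c3).
- apply: cvg_within_filter.
  apply: (continuous_comp (f := fun q : R * 'cV[R]_n * 'cV[R]_n => (q.1.2, q.2))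
    (g := fun q : 'cV[R]_n * 'cV[R]_n => Psi q.1 q.2)); last exact: cPsi.
  exact: (cvg_pair c2 c3).
Qed.

Let S := 2 * A / lambda + om.

Let S0 : 0 < S.
Proof. by rewrite addr_gt0// divr_gt0// mulr_gt0. Qed.

(** At a positive maximum of exp(- lambda (T - t)) w - S the time derivative is
    at most - lambda w / 2 and the second order term at most of order eta,
    which contradicts the lower bound - A exp(lambda (T - t)) as soon as
    lambda S / 2 exceeds A. *)
Lemma sup_estimate_above (w : R -> 'cV[R]_n -> R) :
  {within `[s0, T] `*` setT, continuous (unc2 w)} ->
  (forall t x, s0 <= t <= T -> `|w t x| <= B) ->
  (forall x, `|w T x| <= om) ->
  parabolic_bound sigma T s0 lambda A w ->
  forall t x, s0 <= t <= T -> w t x <= S * E t.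
Proof.
move=> cw wB wT wA t0 x0 ht0; rewrite leNgt; apply/negP => hlt.
pose u t (x y : 'cV[R]_n) := expR (- (lambda * (T - t))) * (w t x - 0 * w t y) - S.
have uE t x y : u t x y = (E t)^-1 * w t x - S by rewrite /u mul0r subr0 expRE.
have cu : {within `[s0, T] `*` setT `*` setT, continuous (unc3 u)}.
  by apply: doubled_test_continuous => // q; exact: cvg_cst.
have u0 : 0 < u t0 x0 0.
  by rewrite uE subr_gt0 mulrC ltr_pdivlMr.
have N0 : 0 <= inner x0 x0 + inner 0 (0 : 'cV[R]_n).
  by apply: addr_ge0; exact: inner_ge0.
have om'0 : 0 < Num.min (u t0 x0 0) (lambda * om / 2).
  by rewrite lt_min u0 divr_gt0// mulr_gt0.
have [eta [eta0]] := exists_small_factor N0 (ltW Cs0) om'0.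
rewrite !lt_min => /andP[h1 _] /andP[_ h2].
have uB t (x y : 'cV[R]_n) : s0 <= t <= T -> u t x y <= B.
  move=> ht; have /andP[_ tT] := ht.
  have /andP[e0 e1] := weight_le1 tT.
  have := ler_normlW (wB t x ht); have := le_trans (normr_ge0 _) (wB t x ht).
  rewrite uE -expRE; have := S0; nra.
have [t [x [y [ht ut tmax xmax]]]] := penalized_max cu eta0 uB ht0 h1.
have /andP[st tT'] := ht.
rewrite uE subr_gt0 mulrC ltr_pdivlMr// in ut.
have tT : t < T.
  rewrite lt_neqAle tT' andbT; apply/eqP => tT; rewrite tT in ut.
  have := ler_normlW (wT x); rewrite /E subrr mulr0 expR0 mulr1 in ut.
  have : 0 < 2 * A / lambda by rewrite divr_gt0// mulr_gt0.
  rewrite /S in ut; lra.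
have [D [X [hD hX hDX]]] := wA t x st tT.
have Dle : D <= - (lambda / 2) * w t x.
  apply: (weighted_right_derivative l0 tT _ hD).
    by apply: ltW; apply: lt_trans ut; rewrite mulr_gt0.
  move=> s /andP[ts sT]; have := tmax s.
  rewrite (le_trans st ts) sT => /(_ isT).
  by rewrite !uE !expRE lerD2r.
have Xle p : inner p (X *m p) <= 2 * eta * inner p p * E t.
  apply: (second_difference_le (hX p)); near=> s.
  have := xmax (s *: p) 0; rewrite !uE !innerE => h.
  have {h} h : (E t)^-1 * (w t (x + s *: p) + w t (x - s *: p) - 2 * w t x)
      <= 2 * eta * inner p p * s ^+ 2.
    have -> : 2 * eta * inner p p * s ^+ 2 = 2 * eta * (s * (s * inner p p) + 0).
      by ring.
    have i0 : inner (0 : 'cV[R]_n) 0 = 0.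
      by rewrite /inner big1// => i _; rewrite mxE mul0r.
    by rewrite i0 in h; lra.
  by rewrite mulrAC -ler_pdivrMr// mulrC.
have trle : \tr (acoef sigma t x *m X) <= eta * Cs * E t.
  rewrite tr_gram_mul.
  have : \sum_(i < d) inner (col i (sigma t x)) (X *m col i (sigma t x))
      <= 2 * eta * frob2 (sigma t x) * E t.
    rewrite /frob2 mulr_sumr mulr_suml; apply: ler_sum => i _; exact: Xle.
  have : eta * E t * frob2 (sigma t x) <= eta * E t * Cs.
    by rewrite ler_wpM2l ?frob_bound// mulr_ge0// ltW.
  lra.
have := ler_normlW (eq_ind_r (fun z => z <= _) hDX (normrN _)).
rewrite -/(E t) => hlow.
have h3 : lambda / 2 * (S * E t) < lambda / 2 * w t x.
  by rewrite ltr_pM2l// divr_gt0.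
have h4 : eta * Cs * E t < lambda * om / 2 * E t by rewrite ltr_pM2r.
have h5 : lambda / 2 * (S * E t) = A * E t + lambda * om / 2 * E t.
  by rewrite /S; field; rewrite gt_eqF.
lra.
Unshelve. all: by end_near. Qed.

Lemma sup_estimate {w : R -> 'cV[R]_n -> R} :
  {within `[s0, T] `*` setT, continuous (unc2 w)} ->
  (forall t x, s0 <= t <= T -> `|w t x| <= B) ->
  (forall x, `|w T x| <= om) ->
  parabolic_bound sigma T s0 lambda A w ->
  forall t x, s0 <= t <= T -> `|w t x| <= S * E t.
Proof.
move=> cw wB wT wA t x ht; rewrite ler_norml; apply/andP; split; last first.
  exact: sup_estimate_above.
rewrite lerNl; apply: (@sup_estimate_above (fun t x => - w t x)) => //.
- move=> q; exact: (continuousN (cw q)).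
- by move=> t' x' ht'; rewrite normrN wB.
- by move=> x'; rewrite normrN.
- exact: parabolic_boundN.
Qed.

Variables (lambda0 lambda1 C r1 : R).
Hypotheses (l00 : 0 < lambda0) (l10 : 0 < lambda1) (C0 : 0 <= C) (r10 : 0 < r1).
Hypothesis elliptic : forall t x, s0 <= t <= T ->
  [/\ acoef sigma t x \in unitmx,
      loewner_le lambda0%:M (invmx (acoef sigma t x)) &
      loewner_le (invmx (acoef sigma t x)) lambda1%:M].
Hypothesis frob_lipschitz : forall t x y, s0 <= t <= T ->
  frob2 (sigma t x - sigma t y) <= C * enorm (x - y) ^+ 2.
Hypothesis r1_small : 3 * C * r1 ^+ 2 * lambda1 <= 1.
Hypothesis r1_sup : 2 * S <= lambda1 * A * r1 ^+ 2.
Hypothesis r1_terminal : om <= lambda1 * A * r1.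

(* phi is concave with phi'' = - 2 be, and r1 is the point where its slope
   vanishes; Psi continues phi(|x - y|) by the constant phi(r1), which the sup
   estimate makes larger than any difference of values of w. *)
Let be := lambda1 * A.
Let al := 2 * be * r1.
Let phi (r : R) := al * r - be * r ^+ 2.
Let Psi (x y : 'cV[R]_n) := phi (Num.min (enorm (x - y)) r1).

Let be0 : 0 < be. Proof. exact: mulr_gt0. Qed.

Let al0 : 0 < al. Proof. by rewrite !mulr_gt0. Qed.

Let Psi_continuous : continuous (fun q : 'cV[R]_n * 'cV[R]_n => Psi q.1 q.2).
Proof.
have cm : continuous (fun q : 'cV[R]_n * 'cV[R]_n =>
    Num.min (enorm (q.1 - q.2)) r1).
  have ce : continuous (fun q : 'cV[R]_n * 'cV[R]_n => enorm (q.1 - q.2)).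
    move=> q; apply: (continuous_comp (f := fun q : 'cV[R]_n * 'cV[R]_n => q.1 - q.2)
      (g := @enorm R n)); last exact: enorm_continuous.
    by apply: cvgB; [exact: cvg_fst|exact: cvg_snd].
  move=> q; exact: (continuous_min (ce q) (cvg_cst r1)).
have cphi : continuous phi.
  move=> r; apply: cvgB; apply: cvgM; (try exact: cvg_cst); first exact: cvg_id.
  exact: exprn_continuous.
by move=> q; apply: (continuous_comp (cm q)); exact: cphi.
Qed.

Let Psi_inside (x y : 'cV[R]_n) : enorm (x - y) <= r1 -> Psi x y = phi (enorm (x - y)).
Proof. by move=> h; rewrite /Psi min_l. Qed.

Let Psi_outside (x y : 'cV[R]_n) : r1 <= enorm (x - y) -> Psi x y = be * r1 ^+ 2.
Proof. by move=> h; rewrite /Psi min_r// /phi /al; ring. Qed.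

(** The second difference of al |x - y| - be |x - y|^2 in the direction (p, q)
    is controlled by the component of p - q orthogonal to x - y, and is made
    negative by the term in be. *)
Let Psi_second_difference (x y p q : 'cV[R]_n) :
  0 < enorm (x - y) -> enorm (x - y) < r1 ->
  \forall s \near (0 : R)^'+,
    Psi (x + s *: p) (y + s *: q) + Psi (x - s *: p) (y - s *: q) - 2 * Psi x y
    <= (2 * al * (inner (p - q) (p - q)
          - inner (p - q) (x - y) ^+ 2 / enorm (x - y) ^+ 2) / enorm (x - y)
        - 2 * be * inner (p - q) (p - q)) * s ^+ 2.
Proof.
set z := x - y; set v := p - q => z0 zr.
have near_in : \forall s \near (0 : R), enorm (z + s *: v) < r1.
  have ce : continuous (fun s : R => enorm (z + s *: v)).
    move=> s; apply: (continuous_comp (f := fun s : R => z + s *: v)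
      (g := @enorm R n)); last exact: enorm_continuous.
    apply: cvgD; first exact: cvg_cst.
    exact: scalel_continuous.
  have := ce 0; rewrite /continuous_at scale0r addr0 => /cvgr_lt; exact.
have [dl /= dl0 hdl] := near_in.
near=> s.
have s0' : 0 < s by near: s; exact: nbhs_right_gt.
have sdl : s < dl by near: s; exact: nbhs_right_lt.
have sv : s < enorm z ^+ 2 / (2 * (`|inner v z| + 1)).
  near: s; apply: nbhs_right_lt.
  by rewrite divr_gt0 ?exprn_gt0// mulr_gt0.
have e1 : x + s *: p - (y + s *: q) = z + s *: v.
  by rewrite /z /v scalerBr opprD addrACA.
have e2 : x - s *: p - (y - s *: q) = z - s *: v.
  by rewrite /z /v scalerBr !opprD !opprK addrACA.
have h1 : enorm (z + s *: v) < r1.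
  by apply: hdl; rewrite /= sub0r normrN gtr0_norm.
have h2 : enorm (z - s *: v) < r1.
  by rewrite -scaleNr; apply: hdl; rewrite /= sub0r opprK gtr0_norm.
have hs : `|s| * `|inner v z| <= enorm z ^+ 2 / 2.
  rewrite gtr0_norm//; have v1 := normr_ge0 (inner v z).
  have : s * (2 * (`|inner v z| + 1)) <= enorm z ^+ 2.
    have pos : 0 < 2 * (`|inner v z| + 1) by rewrite mulr_gt0// ltr_wpDl.
    by rewrite -ler_pdivlMr//; exact: ltW.
  nra.
have key := enorm_second_difference z0 hs.
rewrite !Psi_inside ?e1 ?e2 ?(ltW h1) ?(ltW h2) ?(ltW zr)// -/z /phi !enorm_sqr.
have NE : inner (z + s *: v) (z + s *: v) + inner (z - s *: v) (z - s *: v)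
    = 2 * inner z z + 2 * (s ^+ 2 * inner v v).
  exact: inner_parallelogram.
have keyal : al * (enorm (z + s *: v) + enorm (z - s *: v) - 2 * enorm z) <=
    al * (2 * s ^+ 2 * (inner v v - inner v z ^+ 2 / enorm z ^+ 2) / enorm z).
  by rewrite ler_wpM2l// ltW.
rewrite enorm_sqr in keyal.
have NEbe : be * (inner (z + s *: v) (z + s *: v) + inner (z - s *: v) (z - s *: v))
    = be * (2 * inner z z + 2 * (s ^+ 2 * inner v v)) by rewrite NE.
move: keyal NEbe.
have -> : al * (2 * s ^+ 2 * (inner v v - inner v z ^+ 2 / inner z z) / enorm z)
  = 2 * al * (inner v v - inner v z ^+ 2 / inner z z) / enorm z * s ^+ 2 by ring.
move: (_ / enorm z) => F; lra.
Unshelve. all: by end_near. Qed.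

(** At a positive maximum of
    exp(- lambda (T - t)) (w(t, x) - w(t, y)) - Psi(x, y) the two equations are
    subtracted after pairing the columns of sigma(t, x) with the reflected
    columns of sigma(t, y): the strict concavity of phi then outweighs the
    right-hand sides. *)
Lemma gradient_estimate {w : R -> 'cV[R]_n -> R} :
  {within `[s0, T] `*` setT, continuous (unc2 w)} ->
  (forall t x, s0 <= t <= T -> `|w t x| <= B) ->
  (forall x, `|w T x| <= om) ->
  (forall x y, `|w T x - w T y| <= om * enorm (x - y)) ->
  parabolic_bound sigma T s0 lambda A w ->
  forall t x y, s0 <= t <= T ->
    w t x - w t y <= 2 * lambda1 * A * r1 * enorm (x - y) * E t.
Proof.
move=> cw wB wT wTlip wA.
have wS := sup_estimate cw wB wT wA.
pose u t (x y : 'cV[R]_n) :=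
  expR (- (lambda * (T - t))) * (w t x - 1 * w t y) - Psi x y.
have uE t x y : u t x y = (E t)^-1 * (w t x - w t y) - Psi x y.
  by rewrite /u mul1r expRE.
suff hu t x y : s0 <= t <= T -> u t x y <= 0.
  move=> t x y ht; have := hu t x y ht.
  rewrite uE subr_le0 mulrC ler_pdivrMr// => /le_trans; apply.
  rewrite ler_wpM2r ?(ltW (E0 t))//.
  have -> : 2 * lambda1 * A * r1 = al by rewrite /al /be; ring.
  have r0 := enorm_ge0 (x - y).
  have [h|h] := leP (enorm (x - y)) r1.
    rewrite Psi_inside// /phi.
    by have := mulr_ge0 (ltW be0) (sqr_ge0 (enorm (x - y))); lra.
  rewrite Psi_outside ?(ltW h)// /al.
  apply: (@le_trans _ _ (2 * be * r1 * r1)); last first.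
    by apply: ler_wpM2l; [exact: (ltW al0)|exact: ltW].
  by have := mulr_ge0 (ltW be0) (sqr_ge0 r1); rewrite expr2; lra.
move=> {}ht; rename t into t0, x into x0, y into y0; rename ht into ht0.
rewrite leNgt; apply/negP => u0.
have cu : {within `[s0, T] `*` setT `*` setT, continuous (unc3 u)}.
  exact: doubled_test_continuous.
have diffS t x y : s0 <= t <= T -> (E t)^-1 * (w t x - w t y) <= 2 * S.
  move=> ht; rewrite mulrC ler_pdivrMr//.
  have /ler_normlP[_ h1] := wS t x ht; have /ler_normlP[h2 _] := wS t y ht.
  lra.
have Psi0 x y : 0 <= Psi x y.
  rewrite /Psi /phi /al; set m := Num.min _ _.
  have m0 : 0 <= m by rewrite le_min enorm_ge0 ltW.
  have m1 : m <= r1 by rewrite ge_min lexx orbT.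
  have -> : 2 * be * r1 * m - be * m ^+ 2 = be * m * (2 * r1 - m) by ring.
  by rewrite mulr_ge0//; [apply: mulr_ge0 => //; exact: ltW|lra].
have N0 : 0 <= inner x0 x0 + inner y0 y0 by apply: addr_ge0; exact: inner_ge0.
have min0 : 0 < Num.min (u t0 x0 y0) (A / 2) by rewrite lt_min u0 divr_gt0.
have [eta [eta0]] := exists_small_factor N0 (ltW Cs0) min0.
rewrite !lt_min => /andP[h1 _] /andP[_ h2].
have uB t x y : s0 <= t <= T -> u t x y <= 2 * S.
  by move=> ht; rewrite uE; have := diffS t x y ht; have := Psi0 x y; lra.
have [t [x [y [ht ut tmax xmax]]]] := penalized_max cu eta0 uB ht0 h1.
have /andP[st tT'] := ht.
have wpos : 0 < w t x - w t y.
  have : 0 < (E t)^-1 * (w t x - w t y) by rewrite uE in ut; have := Psi0 x y; lra.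
  by rewrite pmulr_rgt0// invr_gt0.
set z := x - y; have r_ge0 := enorm_ge0 z.
have zr : enorm z < r1.
  rewrite ltNge; apply/negP => h; move: ut; rewrite uE Psi_outside//.
  have := diffS t x y ht; rewrite /be; move: r1_sup; lra.
have z0 : 0 < enorm z.
  rewrite lt_neqAle r_ge0 andbT eq_sym; apply/eqP => /enorm_eq0 /subr0_eq exy.
  by move: wpos; rewrite exy subrr ltxx.
have tT : t < T.
  rewrite lt_neqAle tT' andbT; apply/eqP => etT; move: ut.
  rewrite uE etT /E subrr mulr0 expR0 invr1 mul1r Psi_inside ?ltW// -/z.
  have := ler_normlW (wTlip x y); rewrite -/z.
  have : om * enorm z <= be * r1 * enorm z by rewrite ler_wpM2r.
  have : be * enorm z ^+ 2 <= be * r1 * enorm z.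
    by rewrite expr2 -mulrA ler_pM2l// ler_wpM2r// ltW.
  rewrite /phi /al; lra.
have [Dx [X [hDx hX hDX]]] := wA t x st tT.
have [Dy [Y [hDy hY hDY]]] := wA t y st tT.
have Dle : Dx - Dy <= 0.
  have : Dx - Dy <= - (lambda / 2) * (w t x - w t y).
    apply: (@weighted_right_derivative _ T lambda t _ (fun s => w s x - w s y)) => //.
    - exact: ltW.
    - have -> : (fun s => (w s x - w s y - (w t x - w t y)) / (s - t)) =
          (fun s => (w s x - w t x) / (s - t) - (w s y - w t y) / (s - t)).
        by apply/funext => s; rewrite -mulrBl; congr (_ / _); ring.
      exact: cvgB.
    - move=> s /andP[ts sT]; have := tmax s.
      rewrite (le_trans st ts) sT => /(_ isT).
      by rewrite !uE !expRE lerD2r.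
  have : 0 < lambda / 2 * (w t x - w t y) by rewrite mulr_gt0// divr_gt0.
  lra.
have pair p q : inner p (X *m p) - inner q (Y *m q) <=
    (2 * al * (inner (p - q) (p - q)
          - inner (p - q) z ^+ 2 / enorm z ^+ 2) / enorm z
        - 2 * be * inner (p - q) (p - q)
        + 2 * eta * (inner p p + inner q q)) * E t.
  set c := (X in _ <= X * _).
  have hXY := cvgB (hX p) (hY q).
  apply: (@second_difference_le _ (fun s : R =>
    (w t (x + s *: p) + w t (x - s *: p) - 2 * w t x)
    - (w t (y + s *: q) + w t (y - s *: q) - 2 * w t y))).
    have -> : (fun s : R => ((w t (x + s *: p) + w t (x - s *: p) - 2 * w t x)
      - (w t (y + s *: q) + w t (y - s *: q) - 2 * w t y)) / s ^+ 2)
      = (fun s => (w t (x + s *: p) + w t (x - s *: p) - 2 * w t x) / s ^+ 2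
       - (w t (y + s *: q) + w t (y - s *: q) - 2 * w t y) / s ^+ 2).
      by apply/funext => s; rewrite mulrBl.
    exact: hXY.
  near=> s.
  have hPsi : Psi (x + s *: p) (y + s *: q) + Psi (x - s *: p) (y - s *: q)
      - 2 * Psi x y
    <= (2 * al * (inner (p - q) (p - q)
          - inner (p - q) z ^+ 2 / enorm z ^+ 2) / enorm z
        - 2 * be * inner (p - q) (p - q)) * s ^+ 2.
    by near: s; exact: Psi_second_difference.
  have := xmax (s *: p) (s *: q); rewrite !uE !innerE => hm.
  rewrite [leRHS]mulrAC -ler_pdivrMr// [leLHS]mulrC.
  have -> : c * s ^+ 2 = (2 * al * (inner (p - q) (p - q)
          - inner (p - q) z ^+ 2 / enorm z ^+ 2) / enorm z
        - 2 * be * inner (p - q) (p - q)) * s ^+ 2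
     + 2 * eta * (s * (s * inner p p) + s * (s * inner q q)).
    by rewrite /c; move: (_ / enorm z) => F; ring.
  lra.
have [aU ell0 ell1] := elliptic t y ht.
have [Q [QQ Qperp Qlow]] :=
  reflection_coupling (sigma t x) l00 l10 aU ell0 ell1 z0.
pose Sx := sigma t x; pose Delta := sigma t x - sigma t y.
have trX : \tr (acoef sigma t x *m X)
    = 2^-1 * \sum_(i < d) inner (col i Sx) (X *m col i Sx).
  exact: tr_gram_mul.
have trY : \tr (acoef sigma t y *m Y)
    = 2^-1 * \sum_(i < d) inner (col i Q) (Y *m col i Q).
  by rewrite /acoef -QQ; exact: tr_gram_mul.
have frobQ : frob2 Q = frob2 (sigma t y) by rewrite !frob2_tr QQ.
have frobD : frob2 Delta <= C * enorm z ^+ 2 by exact: frob_lipschitz.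
have sum_le : \sum_(i < d) (inner (col i Sx) (X *m col i Sx)
     - inner (col i Q) (Y *m col i Q)) <=
   (2 * al * frob2 Delta / enorm z - 2 * be * frob2 (Sx - Q)
     + 2 * eta * (frob2 Sx + frob2 Q)) * E t.
  rewrite [leRHS](_ : _ = \sum_(i < d)
    ((2 * al * inner (col i Delta) (col i Delta) / enorm z
      - 2 * be * inner (col i (Sx - Q)) (col i (Sx - Q))
      + 2 * eta * (inner (col i Sx) (col i Sx) + inner (col i Q) (col i Q))) * E t)).
    apply: ler_sum => i _; apply: (le_trans (pair _ _)).
    have -> : col i Sx - col i Q = col i (Sx - Q).
      by apply/matrixP => j k; rewrite !mxE.
    rewrite ler_wpM2r ?(ltW (E0 t))// lerD2r lerD2r ler_wpM2r ?invr_ge0//.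
    by rewrite ler_wpM2l ?Qperp// mulr_ge0// ltW.
  rewrite -mulr_suml; congr (_ * _).
  by rewrite big_split sumrB /= -mulr_suml -!mulr_sumr big_split.
have zz : frob2 Delta / enorm z <= C * enorm z.
  by rewrite ler_pdivrMr// -mulrA -expr2.
have hal : al * (frob2 Delta / enorm z) <= al * (C * r1).
  rewrite ler_pM2l//; apply: (le_trans zz).
  by apply: ler_wpM2l => //; exact: ltW.
have hr2 : C * enorm z ^+ 2 <= C * r1 ^+ 2.
  by apply: ler_wpM2l => //; rewrite ler_pXn2r ?nnegrE ?ltW.
have hbe : be * (4 / lambda1 - C * r1 ^+ 2) <= be * frob2 (Sx - Q).
  rewrite ler_pM2l//; apply: le_trans Qlow; rewrite lerD2l lerN2.
  exact: le_trans hr2.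
have heta : eta * (frob2 Sx + frob2 Q) <= eta * (2 * Cs).
  rewrite ler_pM2l// frobQ.
  by have := frob_bound t x ht; have := frob_bound t y ht; rewrite /Sx; lra.
have trle : \tr (acoef sigma t x *m X) - \tr (acoef sigma t y *m Y)
   <= (al * (C * r1) - be * (4 / lambda1 - C * r1 ^+ 2) + eta * (2 * Cs)) * E t.
  rewrite trX trY -mulrBr -sumrB.
  apply: (@le_trans _ _ ((al * (frob2 Delta / enorm z) - be * frob2 (Sx - Q)
      + eta * (frob2 Sx + frob2 Q)) * E t)).
    rewrite -[leLHS]mulrC ler_pdivrMr//; apply: (le_trans sum_le).
    by rewrite le_eqVlt; apply/orP; left; apply/eqP; ring.
  by rewrite ler_wpM2r ?(ltW (E0 t))//; lra.
have lowx := ler_normlW (eq_ind_r (fun v => v <= _) hDX (normrN _)).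
have upy := ler_normlW hDY.
rewrite -/(E t) in lowx upy.
have hfin : 0 <= (2 * A + (al * (C * r1) - be * (4 / lambda1 - C * r1 ^+ 2)
   + eta * (2 * Cs))) * E t by lra.
rewrite pmulr_lge0// in hfin.
have e4 : be * (4 / lambda1) = 4 * A by rewrite /be; field; rewrite gt_eqF.
have e3 : al * (C * r1) + be * (C * r1 ^+ 2) = A * (3 * C * r1 ^+ 2 * lambda1).
  by rewrite /al /be; ring.
have : A * (3 * C * r1 ^+ 2 * lambda1) <= A by rewrite ger_pMr.
lra.
Unshelve. all: by end_near. Qed.

End GradientEstimate.

(** * Partitions and coefficient bounds *)

(** The values of tau for which Theta^Pi(tau, .) is Theta^k. *)
Definition belongs {R : realType} (T : R) (s : seq R) (k : nat) (tau : R) :=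
  (0 < k <= size s)%N /\
  ((pt T s k.-1 <= tau < pt T s k) || ((k == size s) && (tau == T))).

Section Partition.
Context {R : realType}.
Context {T : R} {s : seq R}.
Hypotheses (T0 : 0 < T) (sP : itv_partition 0 T s).

Lemma pt0 : pt T s 0 = 0. Proof. by []. Qed.

Lemma pt_last : pt T s (size s) = T.
Proof.
by have [_ /eqP e] := sP; rewrite -[RHS]e (last_nth T).
Qed.

Lemma pt_le {i j} : (i <= j <= size s)%N -> pt T s i <= pt T s j.
Proof.
move=> /andP[ij js]; have [ps _] := sP.
have sorted_le : sorted <=%O (0 :: s).
  by apply: sub_path ps => x y; exact: ltW.
by apply: (sorted_leq_nth le_trans lexx) => //; rewrite inE /= ltnS ?(leq_trans ij).
Qed.

Lemma pt_itv {k} : (k <= size s)%N -> 0 <= pt T s k <= T.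
Proof.
move=> ks; apply/andP; split; first exact: (@pt_le 0%N k).
by have := @pt_le k (size s); rewrite ks leqnn pt_last; exact.
Qed.

Lemma mesh_ge {k} : (0 < k <= size s)%N -> pt T s k - pt T s k.-1 <= mesh T s.
Proof.
move=> ks; rewrite /mesh.
apply: (le_bigmax_seq 0 k xpredT (fun k => pt T s k - pt T s k.-1)) => //.
by rewrite mem_index_iota ltnS.
Qed.

Lemma exists_piece {t} : 0 <= t < T ->
  exists2 k, (0 < k <= size s)%N & pt T s k.-1 <= t < pt T s k.
Proof.
move=> /andP[t0 tT].
have exk : exists k, (k <= size s)%N && (t < pt T s k).
  by exists (size s); rewrite leqnn pt_last.
case: (ex_minnP exk) => -[|k] /andP[ks tk] kmin.
  by move: tk; rewrite pt0 ltNge t0.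
exists k.+1 => //=; rewrite tk andbT leNgt; apply/negP => tk'.
by have := kmin k; rewrite tk' (ltnW ks) ltnn => /(_ isT).
Qed.

Lemma belongs_bounds {k tau} : belongs T s k tau ->
  [/\ 0 <= pt T s k.-1, pt T s k.-1 <= tau & tau <= pt T s k].
Proof.
move=> [/andP[k0 ks] h].
have k1s : (k.-1 <= size s)%N by rewrite (leq_trans (leq_pred k)).
have /andP[p0 pT] := pt_itv k1s; split => //.
  by move: h => /orP[/andP[]//|/andP[_ /eqP->]].
by move: h => /orP[/andP[_ /ltW]//|/andP[/eqP-> /eqP->]]; rewrite pt_last.
Qed.

Lemma belongs_mesh {k tau} : belongs T s k tau ->
  `|tau - pt T s k.-1| <= mesh T s.
Proof.
move=> h; have [_ h1 h2] := belongs_bounds h; have [ks _] := h.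
rewrite ger0_norm ?subr_ge0//; apply: le_trans (mesh_ge ks).
by rewrite lerD2r.
Qed.

Lemma exists_belongs {tau} : 0 <= tau <= T -> exists k, belongs T s k tau.
Proof.
move=> /andP[t0]; rewrite le_eqVlt => /orP[/eqP tT|tT].
  exists (size s); split; last by rewrite tT !eqxx orbT.
  rewrite leqnn andbT; case: (s) pt_last => // h.
  by move: T0; rewrite -h ltxx.
have [|k ks kt] := @exists_piece tau; first by rewrite t0.
by exists k; split => //; rewrite kt.
Qed.

Lemma piece_belongs {j t} : (0 < j <= size s)%N -> piece T s j t -> belongs T s j t.
Proof. by move=> js; rewrite /piece /= in_itv /= => h; split => //; rewrite h. Qed.

Lemma piece_after {k tau t} : belongs T s k tau -> tau <= t -> t < T ->
  exists j, [/\ (k <= j)%N, (j <= size s)%N & piece T s j t].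
Proof.
move=> h taut tT; have [ks hk] := h.
have [p0 pt1 _] := belongs_bounds h.
have [|j /andP[j0 js] jt] := @exists_piece t.
  by rewrite tT (le_trans p0) ?(le_trans pt1).
have jpiece : piece T s j t by rewrite /piece /= in_itv.
exists j; split => //.
rewrite leqNgt; apply/negP => jk.
have /andP[_ tj] := jt.
have : pt T s j <= pt T s k.-1.
  apply: pt_le; case: k ks jk {h hk p0 pt1} => // k /= kk.
  by rewrite ltnS => ->; rewrite ltnW.
rewrite leNgt; apply/negP; rewrite negbK.
exact: le_lt_trans (le_trans pt1 taut) tj.
Qed.

End Partition.

Section CoefficientBounds.
Context {R : realType} {n d m : nat}.
Context {T : R} {U : set 'cV[R]_m}.
Context {b : R -> 'cV[R]_n -> 'cV[R]_m -> 'cV[R]_n}.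
Context {sigma : R -> 'cV[R]_n -> 'M[R]_(n, d)}.
Context {g : R -> R -> 'cV[R]_n -> 'cV[R]_m -> R -> 'rV[R]_d -> R}.
Context {h : R -> 'cV[R]_n -> R}.
Context {psi : R -> R -> 'cV[R]_n -> R -> 'cV[R]_n -> 'cV[R]_m}.

(** h_mixed encodes the bound on the derivative of h in both tau and x: it makes
    the terminal gap small together with its Lipschitz constant. *)
Record coef_bounds (K : R) : Prop := CoefBounds {
  K_ge1 : 1 <= K;
  sigma_bound : forall t x, timeI T t -> `|sigma t x| <= K;
  b_bound : forall t x u, timeI T t -> U u -> `|b t x u| <= K;
  b_lip : forall t x u u', timeI T t -> U u -> U u' ->
    `|b t x u - b t x u'| <= K * `|u - u'|;
  g_lip : forall tau tau' t x u u' y y' z z',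
    timeD T (tau, t) -> timeD T (tau', t) -> U u -> U u' ->
    `|g tau t x u y z - g tau' t x u' y' z'|
      <= K * (`|tau - tau'| + `|u - u'| + `|y - y'| + `|z - z'|);
  psi_lip : forall tau tau' t x y y' p p',
    timeD T (tau, t) -> timeD T (tau', t) ->
    `|psi tau t x y p - psi tau' t x y' p'|
      <= K * (`|tau - tau'| + `|y - y'| + `|p - p'|);
  h_lip : forall tau tau' x, timeI T tau -> timeI T tau' ->
    `|h tau x - h tau' x| <= K * `|tau - tau'|;
  h_mixed : forall tau tau' x y, timeI T tau -> timeI T tau' ->
    `|(h tau x - h tau' x) - (h tau y - h tau' y)|
      <= K * `|tau - tau'| * `|x - y|;
  sigma_lip : forall t x y, timeI T t -> `|sigma t x - sigma t y| <= K * `|x - y|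
}.

Lemma htau_lipschitz {L} : 0 < T ->
  assumptionA_differentiable T b sigma g h psi ->
  (forall tau t x thetab pb theta p, timeD T (tau, t) ->
      dnorm (acoef sigma t) x
      + dnorm (fun y => btilde b psi t y thetab pb) x
      + dnorm (fun y => gtilde sigma g psi tau t y thetab pb theta p) x
      + dnorm (fun y => btilde b psi t x y pb) thetab
      + dnorm (fun y => gtilde sigma g psi tau t x y pb theta p) thetab
      + dnorm (fun y => btilde b psi t x thetab y) pb
      + dnorm (fun y => gtilde sigma g psi tau t x thetab y theta p) pb
      + dnorm (fun y => gtilde sigma g psi tau t x thetab pb y p) theta
      + dnorm (fun y => gtilde sigma g psi tau t x thetab pb theta y) p
      + dnorm (h tau) x
      + dnorm (htau T h tau) x <= L) ->
  forall tau x y, timeI T tau ->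
    `|htau T h tau x - htau T h tau y| <= L * `|x - y|.
Proof.
move=> T0 Ad AL tau x y; rewrite /timeI /= in_itv /= => /andP[tau0 tauT].
have hD : timeD T (tau, tau) by rewrite /timeD /= lexx.
apply: lipschitz_scalar => [z|z v].
  by have [_ _ _ [_ _]] := Ad tau tau z 0 0 0 0 hD.
have [d1 [d2 d3 d4] [d5 d6 d7 d8 d9] [d10 _ d11]] := Ad tau tau z 0 0 0 0 hD.
apply: dnorm_bound => //; apply: le_trans (AL tau tau z 0 0 0 0 hD).
by rewrite lerDr !addr_ge0//; exact: dnorm_ge0.
Qed.

(** Mean value theorem in tau for h(tau, x) - h(tau, y), whose derivative is
    htau(tau, x) - htau(tau, y). *)
Lemma htau_mixed {K Kh} : 0 <= Kh ->
  (forall tau tau' x, timeI T tau -> timeI T tau' ->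
     `|h tau x - h tau' x| <= Kh * `|tau - tau'|) ->
  (forall tau x, timeI T tau -> tderivable (timeI T) (h^~ x) tau) ->
  (forall tau x y, timeI T tau ->
     `|htau T h tau x - htau T h tau y| <= K * `|x - y|) ->
  forall tau tau' x y, timeI T tau -> timeI T tau' ->
    `|(h tau x - h tau' x) - (h tau y - h tau' y)|
      <= K * `|tau - tau'| * `|x - y|.
Proof.
move=> Kh0 hL hd hK.
have h_cont x : {within timeI T, continuous (h^~ x)}.
  apply/subspace_continuousP => t ht; apply/cvgrPdist_le => e e0.
  have Kh1 : 0 < Kh + 1 by lra.
  have : \forall t' \near t, `|t - t'| <= e / (Kh + 1).
    have /cvgrPdist_le : (fun z : R => z) @ t --> t by exact: cvg_id.
    by apply; exact: divr_gt0.
  rewrite near_withinE; apply: filterS => t' tt' ht'.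
  apply: (le_trans (hL _ _ _ ht ht')).
  rewrite ler_pdivlMr// in tt'; have := normr_ge0 (t - t'); nra.
have main x y t t' : timeI T t -> timeI T t' -> t <= t' ->
    `|(h t' x - h t' y) - (h t x - h t y)| <= K * `|x - y| * (t' - t).
  rewrite /timeI /= !in_itv /= => /andP[t0 tT] /andP[t'0 t'T] tt'.
  apply: (@is_derive_lipschitz _ 0 T (fun u => h u x - h u y)
    (fun u => htau T h u x - htau T h u y)) => //.
  - by move=> u; exact: continuousB (h_cont x u) (h_cont y u).
  - move=> u u0T; have uI : timeI T u.
      by rewrite /timeI /= in_itv /=; move: u0T => /andP[/ltW -> /ltW ->].
    have dx := tderiv_interior (hd u x uI) u0T.
    have dy := tderiv_interior (hd u y uI) u0T.
    exact: is_deriveB.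
  - move=> u u0T; apply: hK.
    by rewrite /timeI /= in_itv /=; move: u0T => /andP[/ltW -> /ltW ->].
move=> tau tau' x y ht ht'; have [tt'|tt'] := leP tau tau'.
  have -> : (h tau x - h tau' x) - (h tau y - h tau' y)
      = - ((h tau' x - h tau' y) - (h tau x - h tau y)) by ring.
  rewrite normrN (distrC tau) (ger0_norm (x := tau' - tau)) ?subr_ge0//.
  by rewrite mulrAC; exact: main.
have -> : (h tau x - h tau' x) - (h tau y - h tau' y)
    = (h tau x - h tau y) - (h tau' x - h tau' y) by ring.
rewrite (ger0_norm (x := tau - tau')) ?subr_ge0 ?(ltW tt')// mulrAC.
by apply: main => //; exact: ltW.
Qed.

Lemma coef_bounds_exist : 0 < T ->
  standing_assumptions T U b sigma g h psi -> exists K, coef_bounds K.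
Proof.
move=> T0 [[_ [L [_ sL _ _]] _] _ [Cb Csig Cg Ch Cpsi] [_ Ad [L' L'0 AL] _]].
have [K1 K10 K1b] := C1b_on_lipschitz_mx Cb.
have [K2 K20 K2b] := C1b_on_bounded Cb.
have [K3 K30 K3b] := C1b_on_bounded Csig.
have [K4 K40 K4b] := C1b_on_lipschitz_scalar Cg.
have [K5 K50 K5b] := C1b_on_lipschitz_scalar Ch.
have [K6 K60 K6b] := C1b_on_lipschitz_mx Cpsi.
have L0 : 0 <= `|L| by [].
pose K := 1 + K1 + K2 + K3 + K4 + K5 + K6 + `|L| + L'.
have leK (c e K' : R) : c <= K' * e -> 0 <= e -> K' <= K -> c <= K * e.
  by move=> h1 e0 KK'; apply: (le_trans h1); rewrite ler_wpM2r.
have pair_le (V W : normedModType R) (v : V) (w : W) : `|(v, w)| <= `|v| + `|w|.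
  rewrite prod_normE /= ge_max lerDl lerDr !normr_ge0//.
have hl tau tau' x : timeI T tau -> timeI T tau' ->
    `|h tau x - h tau' x| <= K5 * `|tau - tau'|.
  move=> ht ht'; apply: (le_trans (K5b (tau, x) (tau', x) _ _)) => //.
  rewrite ler_wpM2l//; apply: (le_trans (pair_le _ _ _ _)).
  by rewrite /= subrr normr0 addr0.
have dtau tau x : timeI T tau -> tderivable (timeI T) (h^~ x) tau.
  move=> ht; have hD : timeD T (tau, tau).
    move: ht; rewrite /timeI /= in_itv /= => /andP[t0 tT].
    by split => //=; rewrite lexx.
  by have [_ _ _ [_ h2 _]] := Ad tau tau x 0 0 0 0 hD; exact: h2.
have hm := htau_mixed K50 hl dtau (htau_lipschitz T0 Ad AL).
exists K; split.
- by rewrite /K; lra.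
- move=> t x ht; apply: (le_trans (K3b (t, x) _)) => //; rewrite /K; lra.
- move=> t x u ht hu; apply: (le_trans (K2b (t, x, u) _)) => //; rewrite /K; lra.
- move=> t x u u' ht hu hu'; apply: (@leK _ _ K1) => //; last by rewrite /K; lra.
  apply: (le_trans (K1b (t, x, u) (t, x, u') _ _)) => //.
  rewrite ler_wpM2l//; apply: (le_trans (pair_le _ _ _ _)).
  rewrite /= gerDr; apply: (le_trans (pair_le _ _ _ _)).
  by rewrite /= !subrr !normr0 addr0.
- move=> tau tau' t x u u' y y' z z' ht ht' hu hu'.
  apply: (@leK _ _ K4) ; first last; [by rewrite /K; lra|by rewrite !addr_ge0|].
  apply: (le_trans (K4b (tau, t, x, u, y, z) (tau', t, x, u', y', z') _ _)) => //.
  rewrite ler_wpM2l//; apply: (le_trans (pair_le _ _ _ _)); rewrite /= lerD2r.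
  apply: (le_trans (pair_le _ _ _ _)); rewrite /= lerD2r.
  apply: (le_trans (pair_le _ _ _ _)); rewrite /= lerD2r.
  apply: (le_trans (pair_le _ _ _ _)); rewrite /= subrr normr0 addr0.
  by apply: (le_trans (pair_le _ _ _ _)); rewrite /= subrr normr0 addr0.
- move=> tau tau' t x y y' p p' ht ht'.
  apply: (@leK _ _ K6) ; first last; [by rewrite /K; lra|by rewrite !addr_ge0|].
  apply: (le_trans (K6b (tau, t, x, y, p) (tau', t, x, y', p') _ _)) => //.
  rewrite ler_wpM2l//; apply: (le_trans (pair_le _ _ _ _)); rewrite /= lerD2r.
  apply: (le_trans (pair_le _ _ _ _)); rewrite /= lerD2r.
  apply: (le_trans (pair_le _ _ _ _)); rewrite /= subrr normr0 addr0.
  by apply: (le_trans (pair_le _ _ _ _)); rewrite /= subrr normr0 addr0.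
- move=> tau tau' x ht ht'; apply: (@leK _ _ K5) => //; first exact: hl.
  by rewrite /K; lra.
- move=> tau tau' x y ht ht'; rewrite -mulrA; apply: (@leK _ _ L').
  + by rewrite mulrA; exact: hm.
  + exact: mulr_ge0.
  + by rewrite /K; lra.
- move=> t x y ht; apply: (@leK _ _ `|L|) => //; last by rewrite /K; lra.
  by apply: (le_trans (sL _ _ _ ht)); rewrite ler_wpM2r// ler_norm.
Qed.

Lemma hamiltonian_inf {tau t x theta p P} :
  psi_minimizes T U b sigma g psi -> timeD T (tau, t) ->
  inf [set Hamiltonian b sigma g tau t x u theta p P | u in U]
  = Hamiltonian b sigma g tau t x (psi tau t x theta p) theta p P.
Proof.
move=> hpsi hD; have [Upsi hmin] := hpsi tau t x theta p hD.
have lb u : U u -> Hamiltonian b sigma g tau t x (psi tau t x theta p) theta p P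
    <= Hamiltonian b sigma g tau t x u theta p P.
  (* The second order term does not depend on u, so minimality for P = 0,
     which is symmetric, gives minimality for every P. *)
  move=> Uu; have := hmin 0 (trmx0 _ _ _) u Uu.
  by rewrite /Hamiltonian !mulmx0 mxtrace0 !add0r => h0; rewrite -!addrA lerD2l.
apply/eqP; rewrite eq_le; apply/andP; split.
  apply: ge_inf; last by exists (psi tau t x theta p).
  exists (Hamiltonian b sigma g tau t x (psi tau t x theta p) theta p P).
  by move=> _ [u Uu <-]; exact: lb.
apply: lb_le_inf.
  exists (Hamiltonian b sigma g tau t x (psi tau t x theta p) theta p P).
  by exists (psi tau t x theta p).
by move=> _ [u Uu <-]; exact: lb.
Qed.

End CoefficientBounds.

Arguments coef_bounds {R n d m} T U b sigma g h psi K.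

(** * The gap between the game and the equilibrium *)

Lemma normr_mulmx_le {R : realType} {p q r : nat} (A : 'M[R]_(p, q))
    (B : 'M[R]_(q, r)) : `|A *m B| <= q%:R * (`|A| * `|B|).
Proof.
apply: mx_normr_le => [|i j]; first by rewrite !mulr_ge0.
rewrite mxE; apply: (le_trans (ler_norm_sum _ _ _)).
rewrite -[q in q%:R]card_ord -sum1_card natr_sum mulr_suml.
apply: ler_sum => k _; rewrite mul1r normrM.
by apply: ler_pM => //; exact: normr_mx_le.
Qed.

Lemma normr_trmx_le {R : realType} {p q : nat} (A : 'M[R]_(p, q)) : `|A^T| <= `|A|.
Proof. by apply: mx_normr_le => // i j; rewrite mxE; exact: normr_mx_le. Qed.

Lemma grad_sub {R : realType} {n : nat} (f1 f2 : 'cV[R]_n -> R) x :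
  differentiable f1 x -> differentiable f2 x ->
  grad (fun y => f1 y - f2 y) x = grad f1 x - grad f2 x.
Proof.
move=> d1 d2; apply/matrixP => i j; rewrite !mxE.
have -> : (fun y => f1 y - f2 y) = f1 - f2 by [].
by rewrite diffB.
Qed.

Lemma subtract_equations {R : realType} {a1 a2 t1 t2 f1 f2 g1 g2 : R} :
  a1 + (t1 + f1 + g1) = 0 -> a2 + t2 + f2 + g2 = 0 ->
  a1 - a2 + (t1 - t2) = - ((f1 + g1) - (f2 + g2)).
Proof. by move=> h1 h2; lra. Qed.

(** Lipschitz constant of the first order terms of the two equations with
    respect to the gaps in time, value and gradient. *)
Definition source_const {R : realType} (n : nat) (K M : R) : R :=
  n%:R * K + n%:R * (3 * K ^+ 2 * M) + K * (2 + 3 * K + n%:R * K).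

Definition frob_const {R : realType} (n d : nat) (K : R) : R :=
  d%:R * (n%:R * K ^+ 2).

(** The weight exp(lambda (T - t)) lets a large lambda absorb the Lipschitz
    dependence of the equations on the gap itself. *)
Definition gap_le {R : realType} {n : nat} (T : R) (s : seq R)
    (Theta : R -> R -> 'cV[R]_n -> R) (Th : nat -> R -> 'cV[R]_n -> R)
    (lambda N : R) :=
  forall k tau t x, belongs T s k tau -> tau <= t <= T ->
    `|Th k t x - Theta tau t x| <= N * expR (lambda * (T - t)) /\
    `|grad (Th k t) x - grad (Theta tau t) x| <= N * expR (lambda * (T - t)).

Lemma frob_const_ge0 {R : realType} (n d : nat) (K : R) : 0 <= frob_const n d K.
Proof. by apply: mulr_ge0 => //; apply: mulr_ge0 => //; exact: sqr_ge0. Qed.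

Section Comparison.
Context {R : realType} {n d m : nat} {T : R} {U : set 'cV[R]_m}.
Context {b : R -> 'cV[R]_n -> 'cV[R]_m -> 'cV[R]_n}.
Context {sigma : R -> 'cV[R]_n -> 'M[R]_(n, d)}.
Context {g : R -> R -> 'cV[R]_n -> 'cV[R]_m -> R -> 'rV[R]_d -> R}.
Context {h : R -> 'cV[R]_n -> R}.
Context {psi : R -> R -> 'cV[R]_n -> R -> 'cV[R]_n -> 'cV[R]_m}.
Context {Theta : R -> R -> 'cV[R]_n -> R} {K M : R}.
Hypotheses (T0 : 0 < T) (HK : coef_bounds T U b sigma g h psi K).
Hypothesis psi_min : psi_minimizes T U b sigma g psi.
Hypothesis h_diff : forall tau x, timeI T tau -> differentiable (h tau) x.
Hypothesis Theta_sol : equilibrium_HJB_solution T b sigma g h psi Theta.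
Hypothesis Theta_bound : forall tau t x, timeD T (tau, t) ->
  `|Theta tau t x| <= M /\ `|grad (Theta tau t) x| <= M.
Hypothesis M0 : 0 <= M.

Lemma source_const_gt0 : 0 < source_const n K M.
Proof.
have [K1 _ _ _ _ _ _ _ _] := HK; have n0 : 0 <= n%:R :> R by [].
have K0 : 0 <= K by lra.
have h1 : 0 <= n%:R * K by rewrite mulr_ge0.
have h2 : 0 <= n%:R * (3 * K ^+ 2 * M) by rewrite !mulr_ge0 ?sqr_ge0.
have h3 : 1 <= 2 + 3 * K + n%:R * K by lra.
rewrite /source_const; nra.
Qed.

Lemma source_bound {tau tau' tj t} x {e y y' yd yd' p p' pd pd'} :
  timeD T (tau, t) -> timeD T (tau', t) -> timeD T (tj, t) ->
  `|tau' - tau| <= e -> `|tj - t| <= e ->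
  `|y - y'| <= e -> `|p - p'| <= e -> `|yd - yd'| <= e -> `|pd - pd'| <= e ->
  `|p'| <= M ->
  `|(inner (b t x (psi tj t x yd pd)) p
       + g tau' t x (psi tj t x yd pd) y (p^T *m sigma t x))
    - (inner (b t x (psi t t x yd' pd')) p'
       + g tau t x (psi t t x yd' pd') y' (p'^T *m sigma t x))|
  <= source_const n K M * e.
Proof.
move=> hD hD' hDj et ej ey ep eyd epd p'M.
have [K1 sB bB bL gL pL _ _ _] := HK.
have K0 : 0 <= K by lra.
have e0 : 0 <= e by exact: le_trans ey.
have tI : timeI T t.
  move: hD => [/= t0 /andP[t1 t2]]; rewrite /timeI /= in_itv /= t2 andbT.
  exact: le_trans t1.
have hDd : timeD T (t, t).
  by move: tI; rewrite /timeI /= in_itv /= => /andP[? ?]; split => //=; rewrite lexx.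
set v := psi tj _ _ _ _; set u := psi t _ _ _ _.
have Uv : U v by have [] := psi_min tj t x yd pd hDj.
have Uu : U u by have [] := psi_min t t x yd' pd' hDd.
have vu : `|v - u| <= 3 * K * e.
  apply: (le_trans (pL _ _ _ _ _ _ _ _ hDj hDd)).
  rewrite (mulrC 3) -mulrA ler_wpM2l//; lra.
have b1 : `|inner (b t x v) (p - p')| <= n%:R * (K * e).
  apply: (le_trans (inner_le_norm _ _)); rewrite ler_wpM2l//.
  by apply: ler_pM => //; exact: bB.
have b2 : `|inner (b t x v - b t x u) p'| <= n%:R * (3 * K ^+ 2 * M * e).
  apply: (le_trans (inner_le_norm _ _)); rewrite ler_wpM2l//.
  have -> : 3 * K ^+ 2 * M * e = (K * (3 * K * e)) * M by ring.
  apply: ler_pM => //; apply: (le_trans (bL _ _ _ _ tI Uv Uu)).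
  by rewrite ler_wpM2l.
have z1 : `|p^T *m sigma t x - p'^T *m sigma t x| <= n%:R * (e * K).
  rewrite -mulmxBl -linearB /=; apply: (le_trans (normr_mulmx_le _ _)).
  rewrite ler_wpM2l//; apply: ler_pM => //; last exact: sB.
  exact: le_trans (normr_trmx_le _) ep.
have g1 : `|g tau' t x v y (p^T *m sigma t x) - g tau t x u y' (p'^T *m sigma t x)|
    <= K * (2 + 3 * K + n%:R * K) * e.
  apply: (le_trans (gL _ _ _ _ _ _ _ _ _ _ hD' hD Uv Uu)).
  rewrite -mulrA ler_wpM2l//; lra.
have -> : inner (b t x v) p + g tau' t x v y (p^T *m sigma t x)
    - (inner (b t x u) p' + g tau t x u y' (p'^T *m sigma t x))
  = inner (b t x v) (p - p') + inner (b t x v - b t x u) p'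
    + (g tau' t x v y (p^T *m sigma t x) - g tau t x u y' (p'^T *m sigma t x)).
  rewrite innerDr innerNr innerDl innerNl; ring.
apply: (le_trans (ler_normD _ _)); have := ler_normD (inner (b t x v) (p - p'))
  (inner (b t x v - b t x u) p').
rewrite /source_const; lra.
Qed.

Context {s : seq R} {uPi : R -> 'cV[R]_n -> 'cV[R]_m} {Th : nat -> R -> 'cV[R]_n -> R}.
Hypothesis sP : itv_partition 0 T s.
Hypothesis game : game_recursion T U b sigma g h psi s uPi Th.

Lemma belongs_timeD {k tau t} : belongs T s k tau -> tau <= t <= T ->
  [/\ timeD T (tau, t), timeD T (pt T s k.-1, t) & timeI T t].
Proof.
move=> hk /andP[tt tT]; have [p0 p1 _] := belongs_bounds sP hk.
have tau0 := le_trans p0 p1.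
split; rewrite /timeD /timeI /= ?in_itv /= ?tt ?tT ?p0 ?tau0 ?(le_trans p1 tt)//.
by rewrite (le_trans tau0).
Qed.

(** On the k-th subinterval the infimum in the HJB equation is attained at the
    control uPi, so that Theta^k solves the same semilinear equation on every
    piece. *)
Lemma game_equation {k j t} x : (0 < k)%N -> (k <= j <= size s)%N -> piece T s j t ->
  [/\ C12_on (piece T s j) (Th k),
      uPi t x = psi (pt T s j.-1) t x (Th j t x) (grad (Th j t) x) &
      tderiv (piece T s j) ((Th k)^~ x) t
      + Hamiltonian b sigma g (pt T s k.-1) t x (uPi t x)
          (Th k t x) (grad (Th k t) x) (hess (Th k t) x) = 0].
Proof.
move=> k0 /andP[kj js] jt.
have [_ hg] := game.
have j0 : (0 < j)%N by exact: leq_trans kj.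
have ju : uPi t x = psi (pt T s j.-1) t x (Th j t x) (grad (Th j t) x).
  by have [|_ _ _ h4] := hg j; [rewrite j0|exact: h4].
have ks : (k <= size s)%N by exact: leq_trans js.
have [|_ h2 [h3 h3'] h4] := hg k; first by rewrite k0.
move: kj; rewrite leq_eqVlt => /orP[/eqP kj|kj]; last first.
  by have [|h2a h2b] := h2 j; [rewrite kj|split => //; exact: h2b].
subst j; split => //.
have hb : belongs T s k t by apply: piece_belongs => //; rewrite k0.
have tT : t <= t <= T.
  rewrite lexx /=; have [_ _ h6] := belongs_bounds sP hb.
  by apply: (le_trans h6); have /andP[] := pt_itv sP ks.
have [_ hD _] := belongs_timeD hb tT.
by have := h3' t x jt; rewrite (hamiltonian_inf psi_min hD) (h4 t x jt).
Qed.

Context {mu : R}.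
Hypotheses (mu0 : 0 < mu) (mesh_mu : mesh T s <= mu).

Lemma gap_differentiable {k tau t} x : belongs T s k tau -> tau <= t <= T ->
  differentiable (Th k t) x /\ differentiable (Theta tau t) x.
Proof.
move=> hk /andP[tt tT]; have [ks _] := hk; have /andP[k0 ks'] := ks.
have [_ _ C12 _ hT] := Theta_sol.
have [p0 p1 p2] := belongs_bounds sP hk.
have tauT : tau <= T by exact: le_trans tT.
have tauI : timeI T tau by rewrite /timeI /= in_itv /= tauT andbT (le_trans p0).
move: tT; rewrite le_eqVlt => /orP[/eqP ->|tT].
  have -> : Theta tau T = h tau by apply/funext => y; exact: hT.
  have [_ hg] := game; have [[_ _ h1] _ _ _] := hg k ks.
  have -> : Th k T = h (pt T s k.-1) by apply/funext => y; exact: h1.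
  split; apply: h_diff => //.
  by rewrite /timeI /= in_itv /= p0 (le_trans p1).
split; last first.
  by have [h1 _ _ _] := C12 tau tauI; have [] := h1 t x; rewrite //= in_itv /= tt.
have [j [kj js jt]] := piece_after sP hk tt tT.
have [|[h1 _ _ _] _ _] := game_equation (k := k) (j := j) (t := t) x k0 _ jt.
  by rewrite kj.
by have [] := h1 t x jt.
Qed.

(** The source term sees the control gap, hence the gaps on the diagonal: at time
    t in the j-th piece these are gaps of Theta^j at tau = t, which gap_le
    controls as well since it ranges over all k and tau. *)
Lemma gap_parabolic {lambda N k tau} : 0 <= lambda ->
  gap_le T s Theta Th lambda N -> mu <= N ->
  belongs T s k tau ->
  parabolic_bound sigma T tau lambda (source_const n K M * N)
    (fun t x => Th k t x - Theta tau t x).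
Proof.
move=> l0 gap muN hk t x tt tT.
have ht : tau <= t <= T by rewrite tt ltW.
have [ks _] := hk; have /andP[k0 ks'] := ks.
have [hD hDk tI] := belongs_timeD hk ht.
have [_ _ C12 hEq _] := Theta_sol.
have tauI : timeI T tau.
  have [h0 /andP[h1 h2]] := hD.
  by rewrite /timeI /= in_itv /= h0 (le_trans h1).
have [j [kj js jt]] := piece_after sP hk tt tT.
have jj : (k <= j <= size s)%N by rewrite kj.
have [Cj uE eqk] := game_equation x k0 jj jt.
have [Cj1 _ _ _] := Cj.
have [C1 _ _ _] := C12 tau tauI.
have tin : `[tau, T[%classic t by rewrite /= in_itv /= tt.
have [dk1 dk2 dk3] := Cj1 t x jt.
have [dt1 dt2 dt3] := C1 t x tin.
pose D1 := tderiv (piece T s j) ((Th k)^~ x) t.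
pose D2 := tderiv `[tau, T[ (fun u => Theta tau u x) t.
exists (D1 - D2), (hess (Th k t) x - hess (Theta tau t) x); split.
- have jt' := jt; rewrite /piece /= in_itv /= in jt'; have /andP[j1 j2] := jt'.
  have r1 : ((Th k)^~ x u - (Th k)^~ x t) / (u - t) @[u --> t^'+] --> D1.
    apply: (tderiv_right (pt T s j)) => // u /andP[tu uj].
    by rewrite /piece /= in_itv /= uj (le_trans j1)// ltW.
  have r2 : (Theta tau u x - Theta tau t x) / (u - t) @[u --> t^'+] --> D2.
    apply: (tderiv_right T (f := fun u => Theta tau u x)) => // u /andP[tu uj].
    by rewrite /= in_itv /= uj (le_trans tt)// ltW.
  have -> : (fun u => (Th k u x - Theta tau u x - (Th k t x - Theta tau t x)) / (u - t))
     = (fun u => (Th k u x - Th k t x) / (u - t)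
         - (Theta tau u x - Theta tau t x) / (u - t)).
    by apply/funext => u; rewrite -mulrBl; congr (_ / _); ring.
  exact: cvgB r1 r2.
- move=> p; rewrite mulmxBl innerDr innerNr.
  have q1 := @second_difference_cvg R n (Th k t) x p
    (fun y => let: And3 _ q _ := Cj1 t y jt in q) dk3.
  have q2 := @second_difference_cvg R n (Theta tau t) x p
    (fun y => let: And3 _ q _ := C1 t y tin in q) dt3.
  have -> : (fun u : R => (Th k t (x + u *: p) - Theta tau t (x + u *: p)
      + (Th k t (x - u *: p) - Theta tau t (x - u *: p))
      - 2 * (Th k t x - Theta tau t x)) / u ^+ 2)
    = (fun u => (Th k t (x + u *: p) + Th k t (x - u *: p) - 2 * Th k t x) / u ^+ 2
       - (Theta tau t (x + u *: p) + Theta tau t (x - u *: p)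
          - 2 * Theta tau t x) / u ^+ 2).
    by apply/funext => u; rewrite -mulrBl; congr (_ / _); ring.
  exact: cvgB q1 q2.
- set e := N * expR (lambda * (T - t)).
  have E1 : 1 <= expR (lambda * (T - t)).
    by rewrite -expR0 ler_expR mulr_ge0// subr_ge0 ltW.
  have N0 : 0 <= N by apply: le_trans muN; exact: ltW.
  have mue : mesh T s <= e.
    apply: (le_trans mesh_mu); apply: (le_trans muN).
    by rewrite /e ler_peMr.
  have jb : belongs T s j t.
    by apply: piece_belongs => //; rewrite js andbT (leq_trans k0).
  have tt' : t <= t <= T by rewrite lexx ltW.
  have [_ hDj _] := belongs_timeD jb tt'.
  have [gk1 gk2] := gap k tau t x hk ht.
  have [gj1 gj2] := gap j t t x jb tt'.
  have [_ Mb] := Theta_bound tau t x hD.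
  have e1 : `|pt T s k.-1 - tau| <= e.
    by rewrite distrC; exact: le_trans (belongs_mesh sP hk) mue.
  have e2 : `|pt T s j.-1 - t| <= e.
    by rewrite distrC; exact: le_trans (belongs_mesh sP jb) mue.
  have src := source_bound x hD hDk hDj e1 e2 gk1 gk2 gj1 gj2 Mb.
  rewrite mulmxBr linearB /= -mulrA -/e.
  have eq2 := hEq tau t x hD tT.
  rewrite /Hamiltonian uE -/D1 in eqk; rewrite /equilibrium_control -/D2 in eq2.
  by rewrite (subtract_equations eqk eq2) normrN.
Qed.


Context {lambda0 lambda1 : R}.
Hypotheses (l00 : 0 < lambda0) (l10 : 0 < lambda1).
Hypothesis elliptic : forall t x, timeI T t ->
  [/\ acoef sigma t x \in unitmx,
      loewner_le lambda0%:M (invmx (acoef sigma t x)) &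
      loewner_le (invmx (acoef sigma t x)) lambda1%:M].

Lemma sigma_frob_bound t x : timeI T t -> frob2 (sigma t x) <= (frob_const n d K) + 1.
Proof.
move=> tI; have [_ sB _ _ _ _ _ _ _] := HK.
by apply: (le_trans (frob2_le _ _ (sB t x tI))); rewrite lerDl.
Qed.

Lemma sigma_frob_lipschitz t x y : timeI T t ->
  frob2 (sigma t x - sigma t y) <= (frob_const n d K) * enorm (x - y) ^+ 2.
Proof.
move=> tI; have [K1 _ _ _ _ _ _ _ sL] := HK.
have h1 : `|sigma t x - sigma t y| <= K * enorm (x - y).
  apply: (le_trans (sL _ _ _ tI)); apply: ler_wpM2l; last exact: norm_le_enorm.
  exact: le_trans K1.
apply: (le_trans (frob2_le _ _ h1)); rewrite le_eqVlt; apply/orP; left; apply/eqP.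
by rewrite /frob_const; ring.
Qed.

Lemma gap_continuous {k tau} : belongs T s k tau ->
  {within `[tau, T] `*` setT,
    continuous (unc2 (fun t x => Th k t x - Theta tau t x))}.
Proof.
move=> hk; have [ks _] := hk; have [_ hg] := game.
have [[hc _ _] _ _ _] := hg k ks; have [[Tc _] _ _ _ _] := Theta_sol.
have [p0 p1 p2] := belongs_bounds sP hk.
have c1 : {within `[tau, T] `*` setT, continuous (unc2 (Th k))}.
  apply: continuous_subspaceW hc => -[t x] [/= ht _]; split => //=.
  by move: ht; rewrite !in_itv /= => /andP[ht ->]; rewrite (le_trans p1).
have c2 : {within `[tau, T] `*` setT, continuous (unc2 (Theta tau))}.
  move: Tc => /subspace_continuousP Tc; apply/subspace_continuousP => -[t x] /= [ht _].
  have sub : forall q : R * 'cV[R]_n, (`[tau, T] `*` setT) q ->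
      (timeD T `*` setT) ((tau, q.1), q.2).
    move=> [t' x'] /= [ht' _]; split => //=; move: ht'.
    rewrite /timeD /= in_itv /= => ->.
    by rewrite (le_trans p0).
  have cpi : (fun q : R * 'cV[R]_n => ((tau, q.1), q.2)) @ nbhs (t, x)
      --> ((tau, t), x).
    have a1 : (fun q : R * 'cV[R]_n => (tau, q.1)) @ nbhs (t, x) --> (tau, t).
      have a3 : (fun q : R * 'cV[R]_n => tau) @ nbhs (t, x) --> tau by exact: cvg_cst.
      have a4 : (fun q : R * 'cV[R]_n => q.1) @ nbhs (t, x) --> t by exact: cvg_fst.
      exact: (cvg_pair a3 a4).
    have a2 : (fun q : R * 'cV[R]_n => q.2) @ nbhs (t, x) --> x by exact: cvg_snd.
    exact: (cvg_pair a1 a2).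
  have hpi : (fun q : R * 'cV[R]_n => ((tau, q.1), q.2)) @
      within (`[tau, T] `*` setT) (nbhs (t, x))
      --> within (timeD T `*` setT) (nbhs ((tau, t), x)).
    move=> P /= hP; have := cpi _ hP; rewrite /= /within /=.
    rewrite !nbhs_simpl /=; apply: filterS => q hq hq1.
    by apply: hq; exact: sub.
  have hT := Tc ((tau, t), x) (sub (t, x) (conj ht I)).
  exact: (cvg_comp _ _ hpi hT).
move=> q; exact: continuousB (c1 q) (c2 q).
Qed.

(** Applying the two estimates to a gap of size N bounds it by N / 2, as long as
    N dominates the mesh. *)
Lemma gap_halves {r1 lambda N : R} (A := source_const n K M * N) :
  0 < r1 -> 0 < lambda ->
  3 * (frob_const n d K) * r1 ^+ 2 * lambda1 <= 1 ->
  2 * lambda1 * (source_const n K M) * r1 <= 2^-1 ->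
  2 * (2 * A / lambda + K * mu) <= lambda1 * A * r1 ^+ 2 ->
  K * mu <= lambda1 * A * r1 ->
  2 * A / lambda + K * mu <= N / 2 ->
  mu <= N -> gap_le T s Theta Th lambda N -> gap_le T s Theta Th lambda (N / 2).
Proof.
move=> r10 lam0 hr1 hr2 hS hT hN muN gap k tau t x hk ht.
have N0 : 0 < N by exact: lt_le_trans muN.
have A0 : 0 < A by rewrite mulr_gt0// source_const_gt0.
have [K1 _ _ _ _ _ hL hM _] := HK.
have K0 : 0 < K by exact: lt_le_trans K1.
have om0 : 0 < K * mu by rewrite mulr_gt0.
have Cs0 : 0 < (frob_const n d K) + 1 by have := (frob_const_ge0 n d K); lra.
have [p0 p1 p2] := belongs_bounds sP hk; have tau0 := le_trans p0 p1.
have [ks _] := hk; have [_ hg] := game; have [[_ [Mk hMk] hTh] _ _ _] := hg k ks.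
have inI u : tau <= u <= T -> timeI T u.
  move=> /andP[u1 u2]; rewrite /timeI /= in_itv /= u2 andbT; exact: le_trans u1.
have tauT : tau <= T by move: ht => /andP[h1 h2]; exact: le_trans h2.
have tauI : timeI T tau by apply: inI; rewrite lexx.
have pkI : timeI T (pt T s k.-1).
  by rewrite /timeI /= in_itv /= p0 (le_trans p1).
pose w := fun t x => Th k t x - Theta tau t x.
have cw := gap_continuous hk.
have wB u y : tau <= u <= T -> `|w u y| <= Mk + M.
  move=> hu; apply: (le_trans (ler_normB _ _)); apply: lerD.
    have /andP[u1 u2] := hu.
    by have [] := hMk u y; rewrite // u2 (le_trans p1).
  by have [hD _ _] := belongs_timeD hk hu; have [] := Theta_bound tau u y hD.
have [_ _ _ _ hTT] := Theta_sol.
have wE y : w T y = h (pt T s k.-1) y - h tau y.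
  by rewrite /w hTh hTT.
have gapk : `|pt T s k.-1 - tau| <= mu.
  by rewrite distrC; exact: le_trans (belongs_mesh sP hk) mesh_mu.
have wT y : `|w T y| <= K * mu.
  by rewrite wE; apply: (le_trans (hL _ _ _ pkI tauI)); rewrite ler_wpM2l// ltW.
have wTlip y z : `|w T y - w T z| <= K * mu * enorm (y - z).
  rewrite !wE; apply: (le_trans (hM _ _ _ _ pkI tauI)).
  by apply: ler_pM; rewrite ?norm_le_enorm// ?mulr_ge0 ?ler_wpM2l// ltW.
have wA := gap_parabolic (ltW lam0) gap muN hk.
have fb u y : tau <= u <= T -> frob2 (sigma u y) <= (frob_const n d K) + 1.
  by move=> /inI; exact: sigma_frob_bound.
have sup := sup_estimate sigma T tau lambda A (K * mu) (frob_const n d K + 1) (Mk + M)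
  lam0 A0 om0 Cs0 fb cw wB wT wA.
have grd := gradient_estimate sigma T tau lambda A (K * mu)
  (frob_const n d K + 1) (Mk + M)
  lam0 A0 om0 Cs0 fb lambda0 lambda1 (frob_const n d K) r1
  l00 l10 (frob_const_ge0 n d K) r10
  (fun u y hu => elliptic u y (inI u hu))
  (fun u y z hu => sigma_frob_lipschitz u y z (inI u hu))
  hr1 hS hT cw wB wT wTlip wA.
have E0 : 0 < expR (lambda * (T - t)) by exact: expR_gt0.
split.
  by apply: (le_trans (sup t x ht)); rewrite ler_wpM2r// ltW.
have [d1 d2] := gap_differentiable x hk ht.
rewrite -grad_sub//; apply: norm_grad_le.
- by apply: mulr_ge0; [apply: divr_ge0 => //|]; exact: ltW.
- exact: differentiableB.
have half_le y z : w t y - w t z <=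
    N / 2 * expR (lambda * (T - t)) * enorm (y - z).
  apply: (le_trans (grd t y z ht)).
  rewrite /= [leRHS]mulrAC.
  rewrite ler_wpM2r ?(ltW E0)// ler_wpM2r ?enorm_ge0//.
  have -> : 2 * lambda1 * A * r1 = N * (2 * lambda1 * (source_const n K M) * r1).
    by rewrite /A; ring.
  by rewrite ler_wpM2l// ltW.
move=> y; rewrite ler_norml; apply/andP; split; last exact: half_le.
rewrite lerNl opprB; apply: (le_trans (half_le x y)).
have -> : enorm (x - y) = enorm (y - x).
  by rewrite /enorm -opprB innerNl innerNr opprK.
by [].
Qed.

Lemma gap_le_mono lambda N N' : N <= N' ->
  gap_le T s Theta Th lambda N -> gap_le T s Theta Th lambda N'.
Proof.
move=> NN' gap k tau t x hk ht; have [h1 h2] := gap k tau t x hk ht.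
by split; [apply: (le_trans h1)|apply: (le_trans h2)];
  rewrite ler_wpM2r// ltW// expR_gt0.
Qed.

Lemma gap_initial lambda : 0 <= lambda ->
  exists2 N, 0 < N & gap_le T s Theta Th lambda N.
Proof.
move=> l0; have [_ hg] := game.
have [B [B0 hB]] : exists B, 0 <= B /\ forall k t x, (0 < k <= size s)%N ->
    pt T s k.-1 <= t <= T -> `|Th k t x| <= B /\ `|grad (Th k t) x| <= B.
  suff main j : (j <= size s)%N -> exists B, 0 <= B /\ forall k t x, (0 < k <= j)%N ->
    pt T s k.-1 <= t <= T -> `|Th k t x| <= B /\ `|grad (Th k t) x| <= B.
    exact: main.
  elim: j => [_|j IH js].
    by exists 0; split => // k t x /andP[k0 k0']; rewrite leqNgt k0 in k0'.
  have [B [B0 hB]] := IH (ltnW js).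
  have [|[_ [Bj hBj] _] _ _ _] := hg j.+1; first by rewrite js.
  exists (Num.max B `|Bj|); split; first by rewrite le_max B0.
  move=> k t x /andP[k0]; rewrite leq_eqVlt => /orP[/eqP ->|kj] ht.
    have [h1 h2] := hBj t x ht; have h3 := ler_norm Bj.
    by rewrite !le_max (le_trans h1 h3) (le_trans h2 h3) !orbT.
  have [|h1 h2] := hB k t x _ ht; first by rewrite k0.
  by rewrite !le_max h1 h2.
have BM0 : 0 < B + M + 1 by rewrite ltr_wpDl// addr_ge0.
exists (B + M + 1) => // k tau t x hk ht.
have [hD _ _] := belongs_timeD hk ht; have [ks _] := hk.
have [p0 p1 p2] := belongs_bounds sP hk; have /andP[ht1 ht2] := ht.
have htk : pt T s k.-1 <= t <= T by rewrite ht2 (le_trans p1).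
have [a1 a2] := hB k t x ks htk; have [b1 b2] := Theta_bound tau t x hD.
have E1 : 1 <= expR (lambda * (T - t)).
  by rewrite -expR0 ler_expR mulr_ge0// subr_ge0.
have BM : B + M + 1 <= (B + M + 1) * expR (lambda * (T - t)).
  by rewrite ler_peMr// ltW.
have BM1 : B + M <= B + M + 1 by rewrite lerDl.
by split; apply: le_trans BM; apply: le_trans BM1;
  apply: (le_trans (ler_normB _ _)); exact: lerD.
Qed.

(** The gap is finite for each partition, so halving it repeatedly brings it
    below the threshold c down to which the step is available. *)
Lemma gap_iterate {lambda c : R} : 0 <= lambda -> 0 < c ->
  (forall N, c <= N -> gap_le T s Theta Th lambda N ->
     gap_le T s Theta Th lambda (N / 2)) ->
  gap_le T s Theta Th lambda c.
Proof.
move=> l0 c0 step; have [N0 N00 gap0] := gap_initial lambda l0.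
have iter_gap i : gap_le T s Theta Th lambda (Num.max (N0 / 2 ^+ i) c).
  elim: i => [|i IH].
    by apply: gap_le_mono gap0; rewrite le_max expr0 divr1 lexx.
  apply: (gap_le_mono _ (Num.max (N0 / 2 ^+ i) c / 2)); last first.
    by apply: step => //; rewrite le_max lexx orbT.
  rewrite ler_pdivrMr// ge_max; apply/andP; split.
    have -> : N0 / 2 ^+ i = N0 / 2 ^+ i.+1 * 2.
      by rewrite exprS; field; rewrite expf_neq0.
    by rewrite ler_wpM2r// le_max lexx.
  apply: (@le_trans _ _ (c * 2)); last by rewrite ler_wpM2r// le_max lexx orbT.
  by rewrite ler_peMr ?ler1n// ltW.
pose i := Num.bound (N0 / c).
have hi : N0 / 2 ^+ i <= c.
  rewrite ler_pdivrMr ?exprn_gt0// mulrC -ler_pdivrMr//.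
  apply: (le_trans (ltW (archi_boundP _))); first by rewrite divr_ge0// ltW.
  by rewrite -natrX ler_nat ltnW// ltn_expl.
by have := iter_gap i; rewrite max_r.
Qed.

End Comparison.

(** The constants of the contraction depend on the data only, not on the
    partition: r1 makes the gradient bound small, then lambda makes the sup
    bound small compared with r1^2. *)
Lemma contraction_constants {R : realType} {K K' lambda1 C : R} :
  1 <= K -> 0 < K' -> 0 < lambda1 -> 0 <= C ->
  exists r1 lambda c : R, [/\ 0 < r1, 0 < lambda, 1 <= c &
    [/\ 3 * C * r1 ^+ 2 * lambda1 <= 1, 2 * lambda1 * K' * r1 <= 2^-1 &
      forall mu N, 0 < mu -> c * mu <= N ->
      [/\ 2 * (2 * (K' * N) / lambda + K * mu) <= lambda1 * (K' * N) * r1 ^+ 2,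
          K * mu <= lambda1 * (K' * N) * r1 &
          2 * (K' * N) / lambda + K * mu <= N / 2]]].
Proof.
move=> K1 K'0 l10 C0.
have C1 : 0 < 3 * C * lambda1 + 1 by have := mulr_ge0 C0 (ltW l10); lra.
have lK : 0 < 4 * lambda1 * K' by rewrite !mulr_gt0.
pose r1 := Num.min (4 * lambda1 * K')^-1 (3 * C * lambda1 + 1)^-1.
have r10 : 0 < r1 by rewrite lt_min !invr_gt0 lK C1.
have r1a : 4 * lambda1 * K' * r1 <= 1.
  by rewrite mulrC -ler_pdivlMr// div1r ge_min lexx.
have r1b : (3 * C * lambda1 + 1) * r1 <= 1.
  by rewrite mulrC -ler_pdivlMr// div1r ge_min lexx orbT.
pose q := Num.min 2^-1 (Num.min (lambda1 * K' * r1 ^+ 2 / 2) (lambda1 * K' * r1)).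
have q0 : 0 < q by rewrite !lt_min invr_gt0 ltr0n !mulr_gt0 ?exprn_gt0 ?invr_gt0.
have q1 : q <= 2^-1 by rewrite ge_min lexx.
have q2 : q <= lambda1 * K' * r1 ^+ 2 / 2 by rewrite !ge_min lexx orbT.
have q3 : q <= lambda1 * K' * r1 by rewrite !ge_min lexx !orbT.
exists r1, (4 * K' / q), (2 * K / q); split => //.
- by rewrite divr_gt0// mulr_gt0.
- by rewrite ler_pdivlMr//; lra.
have C0l := mulr_ge0 C0 (ltW l10).
split.
- have h1 : 0 <= 3 * (C * lambda1) * r1 by rewrite !mulr_ge0// ltW.
  have r11 : r1 <= 1 by lra.
  have -> : 3 * C * r1 ^+ 2 * lambda1 = 3 * (C * lambda1) * r1 * r1 by ring.
  by apply: (@le_trans _ _ (3 * (C * lambda1) * r1)); [rewrite ler_piMr|lra].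
- lra.
- move=> mu N mu0 cN; have N0 : 0 < N.
    by apply: lt_le_trans cN; rewrite mulr_gt0// divr_gt0//; lra.
  have e1 : 2 * (K' * N) / (4 * K' / q) = q * N / 2.
    by field; rewrite !gt_eqF.
  have e2 : K * mu <= q * N / 2.
    have : q * (2 * K / q * mu) <= q * N by rewrite ler_pM2l.
    have -> : q * (2 * K / q * mu) = 2 * (K * mu) by field; rewrite gt_eqF.
    lra.
  have qN1 : q * N <= 2^-1 * N by rewrite ler_pM2r.
  have qN2 : q * N <= lambda1 * K' * r1 ^+ 2 / 2 * N by rewrite ler_pM2r.
  have qN3 : q * N <= lambda1 * K' * r1 * N by rewrite ler_pM2r.
  have qN0 : 0 < q * N by rewrite mulr_gt0.
  rewrite e1; split; lra.
Qed.

Theorem mainTheorem3 (R : realType) (n d m : nat) (T : R) (U : set 'cV[R]_m)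
    (b : R -> 'cV[R]_n -> 'cV[R]_m -> 'cV[R]_n)
    (sigma : R -> 'cV[R]_n -> 'M[R]_(n, d))
    (g : R -> R -> 'cV[R]_n -> 'cV[R]_m -> R -> 'rV[R]_d -> R)
    (h : R -> 'cV[R]_n -> R)
    (psi : R -> R -> 'cV[R]_n -> R -> 'cV[R]_n -> 'cV[R]_m)
    (Theta : R -> R -> 'cV[R]_n -> R)
    (ThetaPi : seq R -> R -> R -> 'cV[R]_n -> R) :
  0 < T -> U !=set0 ->
  standing_assumptions T U b sigma g h psi ->
  equilibrium_HJB_solution T b sigma g h psi Theta ->
  (forall s, itv_partition 0 T s ->
     game_value T U b sigma g h psi s (ThetaPi s)) ->
  forall C : set (R * R * 'cV[R]_n),
    compact C -> C `<=` timeD T `*` setT ->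
    forall eps : R, 0 < eps ->
    exists2 delta : R, 0 < delta &
      forall s, itv_partition 0 T s -> mesh T s < delta ->
      forall tau t x, C (tau, t, x) ->
        `|ThetaPi s tau t x - Theta tau t x|
        + `|grad (ThetaPi s tau t) x - grad (Theta tau t) x| < eps.
Proof.
move=> T0 _ standing sol games C _ Csub eps eps0.
have [K HK] := coef_bounds_exist T0 standing.
have [_ psi_min _ [_ Ad _ [lambda0 [lambda1 [l00 l10 ell]]]]] := standing.
have [_ [M hM] _ _ _] := sol.
have K1 : 1 <= K by case: HK.
have timeD_diag tau : timeI T tau -> timeD T (tau, tau).
  by rewrite /timeI /= in_itv /= => /andP[? ?]; split => //=; rewrite lexx.
have h_diff tau x : timeI T tau -> differentiable (h tau) x.
  by move=> /timeD_diag hD; have [_ _ _ []] := Ad tau tau x 0 0 0 0 hD.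
have M0 : 0 <= M.
  have [] := hM 0 0 0; last by move=> h0 _; exact: le_trans h0.
  by apply: timeD_diag; rewrite /timeI /= in_itv /= lexx ltW.
have [r1 [lambda [c [r10 lam0 c1 [hr1 hr2 hc]]]]] := contraction_constants K1
  (source_const_gt0 HK M0) l10 (frob_const_ge0 n d K).
pose E0 := expR (lambda * T).
have E00 : 0 < E0 by exact: expR_gt0.
have c0 : 0 < c by lra.
pose delta := eps / (4 * c * E0).
have delta0 : 0 < delta by rewrite divr_gt0// !mulr_gt0.
exists delta => // s sP smesh tau t x /Csub[/= [tau0 /andP[taut tT]] _].
have [uPi [Th game ThE]] := games s sP.
have gap : gap_le T s Theta Th lambda (c * delta).
  apply: (gap_iterate hM M0 sP game (ltW lam0)); first exact: mulr_gt0.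
  move=> N cN; have [s1 s2 s3] := hc delta N delta0 cN.
  have dN : delta <= N by apply: le_trans cN; rewrite ler_peMl// ltW.
  exact: (gap_halves HK psi_min h_diff sol hM M0 sP game delta0 (ltW smesh)
    l00 l10 ell r10 lam0 hr1 hr2 s1 s2 s3 dN).
have [k hk] : exists k, belongs T s k tau.
  by apply: exists_belongs => //; rewrite tau0 (le_trans taut).
have ht : tau <= t <= T by rewrite taut.
have PiE : ThetaPi s tau t = Th k t.
  by apply/funext => y; have [ks hk'] := hk; exact: ThE.
have [g1 g2] := gap k tau t x hk ht.
rewrite PiE.
have Ele : c * delta * expR (lambda * (T - t)) <= eps / 4.
  have -> : eps / 4 = c * delta * E0 by rewrite /delta; field; rewrite !gt_eqF.
  have t0 : 0 <= t by exact: le_trans taut.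
  apply: ler_wpM2l; first by apply: mulr_ge0; exact: ltW.
  by rewrite ler_expR; apply: ler_wpM2l; [exact: ltW|rewrite gerBl].
lra.
Qed.
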